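(* For every positive integer $n$, the AST partition function at $u_{n+1}=p$, $Z_n(u_1,\ldots,u_n;p)_{\mathrm{AST}}$, is equal to $$\frac{\prod_{i=1}^n\sigma(q^2 p u_i)\,\sigma(q^2 \bar p \bar u_i)\, \prod_{i,j=1}^n\sigma(q^2u_iu_j)\,\sigma(q^2 \bar u_i \bar u_j)} {\sigma(q^2)^{2n}\,\sigma(q^4)^{n(n-1)}\,\prod_{1\le i<j\le n}\sigma(u_i \bar u_j)^2} \;\det_{1\le i,j\le n}\left(\frac{1}{\sigma(q^2u_iu_j)\,\sigma(q^2 \bar u_i \bar u_j)}\right).$$
   Context: Here $p,q,u_1,\dots,u_{n+1}$ are indeterminates; write $\bar x=x^{-1}$ and $\sigma(x)=x-\bar x$. Graph. Let $\mathcal T_n$ be the graph with vertices $(0,j)$, $1\le j\le 2n+1$, and $(i,j)$, $1\le i\le n+1$, $i\le j\le 2n+2-i$ (matrix coordinates: $i$ increases downwards, $j$ increases to the right). Vertical edges join $(i-1,j)$ and $(i,j)$ whenever both are vertices; horizontal edges join $(i,j)$ and $(i,j+1)$ whenever both are vertices and $i\ge1$. Bulk vertices: $(i,j)$ with $1\le i\le n$, $i<j<2n+2-i$ (degree 4). Left boundary vertices: $(i,i)$, $1\le i\le n$ (one edge going up, one going right). Right boundary vertices: $(i,2n+2-i)$, $1\le i\le n$ (one edge going up, one going left). The remaining vertices have degree 1. A configuration is an orientation of $\mathcal T_n$ such that each bulk vertex has two incoming and two outgoing edges and each top edge is directed upwards (from $(1,j)$ to $(0,j)$). The label of the bulk vertex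 $(i,j)$ is $u_iu_{\min(j,2n+2-j)}$, and the label of the boundary vertices $(i,i)$ and $(i,2n+2-i)$ is $u_i$. The weight of a configuration is the product of all vertex weights; degree 1 vertices have weight 1, and the other vertices, with label $u$, have the following weights. Bulk: weight $1$ if both vertical edges are outgoing or both are incoming; $\sigma(q^2u)/\sigma(q^4)$ if both vertical edges point up and both horizontal edges point right, or both vertical edges point down and both horizontal edges point left; $\sigma(q^2\bar u)/\sigma(q^4)$ if both vertical edges point down and both horizontal edges point right, or both vertical edges point up and both horizontal edges point left. Left boundary (AST specialization): vertical edge outgoing and horizontal edge incoming: $\sigma(p\bar u)/\sigma(q^2)$; vertical edge incoming and horizontal edge outgoing: $\sigma(pq^2u)/\sigma(q^2)$; both incoming: $0$; both outgoing: $\sigma(q^2u^2)/\sigma(q^2)$. Right boundary (AST specialization): vertical edge outgoing and horizontal edge incoming: $\sigma(\bar pu)/\sigma(q^2)$; vertical edge incoming and horizontal edge outgoing: $\sigma(\bar pq^2\bar u)/\sigma(q^2)$; both incoming: $0$; both outgoing: $\sigma(q^2\bar u^2)/\sigma(q^2)$. $Z_n(u_1,\dots,u_n;u_{n+1})_{\mathrm{AST}}$ is the sum of the weights of all configurations. *)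

(* Defs.v *)
From HB Require Import structures.
From mathcomp Require Import all_boot all_order all_algebra.
From mathcomp Require Import fraction mpoly.

Set Implicit Arguments.
Unset Strict Implicit.
Unset Printing Implicit Defensive.

Import GRing.Theory.
Local Open Scope nat_scope.

(* Matrix coordinates (row, column), 0 <= row <= n+1 and 0 <= column <= 2n+1.
   The vertices of T_n are the grid points satisfying [is_vertex]. *)
Notation grid n := ('I_n.+2 * 'I_(2 * n).+2)%type.

Section Graph.
Variable n : nat.
Implicit Types (x y : grid n) (o : {set grid n * grid n}).

Definition is_vertex x : bool :=
  if x.1 == 0 :> nat then 1 <= x.2 <= 2 * n + 1
  else (1 <= x.1 <= n.+1) && (x.1 <= x.2 <= 2 * n + 2 - x.1).

Definition vertical_edge x y : bool :=
  [&& is_vertex x, is_vertex y, y.1 == x.1.+1 :> nat & y.2 == x.2 :> nat].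

Definition horizontal_edge x y : bool :=
  [&& is_vertex x, is_vertex y, 1 <= x.1, y.1 == x.1 :> nat
    & y.2 == x.2.+1 :> nat].

Definition adjacent x y : bool :=
  [|| vertical_edge x y, vertical_edge y x,
      horizontal_edge x y | horizontal_edge y x].

Definition is_bulk x : bool := (1 <= x.1 <= n) && (x.1 < x.2 < 2 * n + 2 - x.1).
Definition is_left_boundary x : bool := (1 <= x.1 <= n) && (x.2 == x.1 :> nat).
Definition is_right_boundary x : bool :=
  (1 <= x.1 <= n) && (x.2 == 2 * n + 2 - x.1 :> nat).

(* An orientation is given by its set of arcs: [(x, y) \in o] means that the
   edge joining x and y is directed from x to y. *)
Definition is_orientation o : bool :=
  [forall x, forall y,
    if adjacent x y then ((x, y) \in o) (+) ((y, x) \in o)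
    else (x, y) \notin o].

Definition is_configuration o : bool :=
  [&& is_orientation o,
      [forall x, is_bulk x ==>
        (#|[set y | (y, x) \in o]| == 2) && (#|[set y | (x, y) \in o]| == 2)]
    & [forall x, forall y,
        vertical_edge x y && (x.1 == 0 :> nat) ==> ((y, x) \in o)]].

(* The edge from x in the given direction is outgoing at x.  These are only
   consulted when x has a neighbour in that direction, in which case [inord]
   does not truncate and the edge is incoming at x when the value is false. *)
Definition out_up o x : bool := (x, (inord x.1.-1, x.2)) \in o.
Definition out_down o x : bool := (x, (inord x.1.+1, x.2)) \in o.
Definition out_left o x : bool := (x, (x.1, inord x.2.-1)) \in o.
Definition out_right o x : bool := (x, (x.1, inord x.2.+1)) \in o.

End Graph.

Section Weights.
Local Open Scope ring_scope.
Variable K : fieldType.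

Definition sigma (x : K) : K := x - x^-1.

Variables p q : K.

(* An edge above (resp. to the right of) a vertex points up (resp. right) iff it
   is outgoing; an edge below (resp. to the left) does iff it is incoming.
   The last case does not occur with two incoming and two outgoing edges. *)
Definition bulk_weight (up down left right : bool) (u : K) : K :=
  match up, down, left, right with
  | true, true, _, _ | false, false, _, _ => 1
  | true, false, false, true | false, true, true, false =>
      sigma (q ^+ 2 * u) / sigma (q ^+ 4)
  | false, true, false, true | true, false, true, false =>
      sigma (q ^+ 2 * u^-1) / sigma (q ^+ 4)
  | _, _, _, _ => 0
  end.

(* [vert] and [horiz]: the vertical, resp. horizontal, edge is outgoing. *)
Definition left_weight (vert horiz : bool) (u : K) : K :=
  match vert, horiz with
  | true, false => sigma (p * u^-1) / sigma (q ^+ 2)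
  | false, true => sigma (p * q ^+ 2 * u) / sigma (q ^+ 2)
  | false, false => 0
  | true, true => sigma (q ^+ 2 * u ^+ 2) / sigma (q ^+ 2)
  end.

Definition right_weight (vert horiz : bool) (u : K) : K :=
  match vert, horiz with
  | true, false => sigma (p^-1 * u) / sigma (q ^+ 2)
  | false, true => sigma (p^-1 * q ^+ 2 * u^-1) / sigma (q ^+ 2)
  | false, false => 0
  | true, true => sigma (q ^+ 2 * u^-1 ^+ 2) / sigma (q ^+ 2)
  end.

Variables (n : nat) (u : 'I_n -> K) (v : K).

(* The k-th spectral parameter, 1 <= k <= n+1: the (0-based) family u gives
   u_1, ..., u_n, and v is u_{n+1}. *)
Definition param (k : nat) : K := if insub k.-1 is Some i then u i else v.

Definition vertex_weight (o : {set grid n * grid n}) (x : grid n) : K :=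
  if is_bulk x then
    bulk_weight (out_up o x) (out_down o x) (out_left o x) (out_right o x)
      (param x.1 * param (minn x.2 (2 * n + 2 - x.2)))
  else if is_left_boundary x then
    left_weight (out_up o x) (out_right o x) (param x.1)
  else if is_right_boundary x then
    right_weight (out_up o x) (out_left o x) (param x.1)
  else 1.

Definition Z_AST : K :=
  \sum_(o : {set grid n * grid n} | is_configuration o)
    \prod_(x : grid n | is_vertex x) vertex_weight o x.

End Weights.

(* F(p, q, u_1, ..., u_n) *)
Notation ratfun F n := {fraction {mpoly F[(2 + n)%N]}}.

Section Indeterminates.
Local Open Scope ring_scope.
Variables (F : fieldType) (n : nat).

Definition indet_p : ratfun F n := tofrac 'X_(lshift n ord0).
Definition indet_q : ratfun F n := tofrac 'X_(lshift n ord_max).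
Definition indet_u (i : 'I_n) : ratfun F n := tofrac 'X_(rshift 2 i).

End Indeterminates.

(* Main.v *)
Require Import Defs.
From mathcomp Require Import all_boot all_order all_algebra.
From mathcomp Require Import perm fraction mpoly ring zify.

Set Implicit Arguments.
Unset Strict Implicit.
Unset Printing Implicit Defensive.

Import GRing.Theory.
Local Open Scope ring_scope.

(** Each parameter [u i] is carried by a U-shaped line, which comes down a column
    of the left half, runs along a row and leaves upwards through the mirror
    column; the middle column carries the parameter [p].  The theorem is proved in
    the manner of Izergin and Korepin: after multiplication by the product of the
    [sigma (u i / u j) ^+ 2], both sides are Laurent polynomials in one parameter
    [x] when the others are fixed, and they agree, with multiplicity, at more
    points than their degree allows.  Induction on [n] supplies the values.

    - Symmetry.  The weights satisfy the Yang-Baxter equation ([ybe_vert],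
      [ybe_horiz]) and a reflection equation on each side ([refl_left],
      [refl_right]).  So a crossing put on top of two neighbouring columns on the
      left can be pulled along their two lines until it comes out on the right
      ([triangle_exchange]).  When all top edges point up the crossing is a scalar,
      hence the partition function is symmetric in its parameters
      ([triangle_up_move]), and [x] may be placed in the row that suits best.

    - Degree.  With [x] in the bottom row, only the two columns next to the middle
      one and the three vertices of the bottom row depend on [x].  As the middle
      column carries [p], the contributions of largest degree of the bottom row
      cancel ([bottom_down]), and the degree of the partition function in [x] lies
      between [- 2 n] and [2 n] ([laurent_triangle_up]).

    - Values.  At [x = q ^- 2 / p] and [x = q ^+ 2 / p] the three bottom vertices
      already sum to zero ([triangle_zero]).  With [x] in the top row,
      [x ^+ 2 = q ^- 2] freezes this row ([triangle_up_self]), and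
      [x * v = q ^- 2] or [x * v = q ^+ 2] freezes the rows of [x] and [v]
      ([triangle_up_pair_left], [triangle_up_pair_right]); what remains is the
      partition function without [x], respectively without [x] and [v].

    - Determinant.  Multiplying row [i] of the matrix of the [1 / D i j] by the
      product of the [D i l] over [l] leaves the polynomial determinant
      [pair_det].  It obeys the same reductions, because the vanishing of one
      [D i j] empties a row up to one entry ([pair_det_self], [pair_det_pair]), and
      it vanishes doubly at [x ^+ 2 = v ^+ 2], where two rows and two columns
      coincide ([pair_det_double]).

    - Count.  With [m] parameters besides [x], the difference of the two sides is a
      polynomial of degree at most [4 m + 2] in [x ^+ 2], up to a power of [x], and
      has [m] double and [2 m + 3] simple roots ([factorized_generic]).  These roots
      only have to be distinct, so the argument holds in every characteristic.

    The definition of [Z_AST] as a sum over orientations is turned into the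
    row-by-row sums used above by [Z_AST_triangle_up], and the indeterminates are
    generic enough for the roots to be distinct by [indet_generic]. *)

(** * Vertex weights and their local relations *)

Section Local.
Variables (K : fieldType) (p q : K).
Hypotheses (p0 : p != 0) (q0 : q != 0).

(** The states of the edges around a vertex are recorded by absolute directions:
    [up] and [down] say whether the edge above, resp. below, points up, [left] and
    [right] whether the edge on that side points to the right.  The common
    denominators of the weights are left out, so the weight [1] of a turning line
    becomes [sigma (q ^+ 4)]. *)
Definition bulk (up down left right : bool) (z : K) : K :=
  if up == down then
    if left == right then
      if up == left then sigma (q ^+ 2 * z) else sigma (q ^+ 2 / z)
    else 0
  else if (up == left) && (down == right) then sigma (q ^+ 4) else 0.

Definition lbdry (up right : bool) (z : K) : K :=
  if up then if right then sigma (q ^+ 2 * z ^+ 2) else sigma (p / z)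
  else if right then sigma (p * q ^+ 2 * z) else 0.

Definition rbdry (up left : bool) (z : K) : K :=
  if up then if left then sigma (z / p) else sigma (q ^+ 2 / z ^+ 2)
  else if left then 0 else sigma (q ^+ 2 / (p * z)).

(** Weight of the crossing of two lines whose parameters have ratio [r]; [a], [b]
    are the states of the edges on one side of it and [c], [d] those on the other. *)
Definition rmat (r : K) (a b c d : bool) : K :=
  if a == b then if (a == c) && (b == d) then sigma (q ^+ 4 / r) else 0
  else if (a == c) && (b == d) then sigma (q ^+ 4)
  else if (a == d) && (b == c) then sigma r else 0.

(** Yang-Baxter equation: a crossing of two columns moves down through a row. *)
Lemma ybe_vert (u c1 c2 : K) (a b h k c d : bool) :
    u != 0 -> c1 != 0 -> c2 != 0 ->
  \sum_(a' : bool) \sum_(b' : bool) rmat (c1 / c2) a b a' b' *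
     \sum_(m : bool) bulk a' c h m (u * c1) * bulk b' d m k (u * c2) =
  \sum_(a' : bool) \sum_(b' : bool)
     (\sum_(m : bool) bulk a a' h m (u * c2) * bulk b b' m k (u * c1)) *
     rmat (c1 / c2) a' b' c d.
Proof.
move=> u0 c10 c20.
case: a; case: b; case: h; case: k; case: c; case: d;
  rewrite !big_bool /= /bulk /rmat /= ?(mulr0, mul0r, addr0, add0r) //;
  rewrite /sigma; field; do ?[apply/andP; split]; exact.
Qed.

(** Yang-Baxter equation: a crossing of two rows moves right through a column. *)
Lemma ybe_horiz (u c1 c2 : K) (k h k' h' a d : bool) :
    u != 0 -> c1 != 0 -> c2 != 0 ->
  \sum_(m : bool) \sum_(l : bool) rmat (c1 / c2) k h m l *
     \sum_(b : bool) bulk a b m k' (c1 * u) * bulk b d l h' (c2 * u) =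
  \sum_(m : bool) \sum_(l : bool)
     (\sum_(b : bool) bulk a b k m (c2 * u) * bulk b d h l (c1 * u)) *
     rmat (c1 / c2) m l k' h'.
Proof.
move=> u0 c10 c20.
case: a; case: d; case: h; case: k; case: k'; case: h';
  rewrite !big_bool /= /bulk /rmat /= ?(mulr0, mul0r, addr0, add0r) //;
  rewrite /sigma; field; do ?[apply/andP; split]; exact.
Qed.

(** The left ends of two consecutive rows: both boundary vertices and the bulk
    vertex where the two lines cross. *)
Definition lcorner (u1 u2 : K) (e1 e2 k h : bool) : K :=
  \sum_(m : bool) \sum_(f : bool)
    lbdry e1 m u1 * bulk e2 f m k (u1 * u2) * lbdry f h u2.

Definition rcorner (u1 u2 : K) (k h e2 e1 : bool) : K :=
  \sum_(m : bool) \sum_(f : bool)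
    bulk e2 f k m (u1 * u2) * rbdry e1 m u1 * rbdry f h u2.

(** Reflection equation: a crossing above the left ends of two rows comes out
    between the rows themselves. *)
Lemma refl_left (u1 u2 : K) (e1 e2 k h : bool) : u1 != 0 -> u2 != 0 ->
  \sum_(a : bool) \sum_(b : bool) rmat (u1 / u2) e1 e2 a b * lcorner u1 u2 a b k h =
  \sum_(a : bool) \sum_(b : bool) lcorner u2 u1 e1 e2 a b * rmat (u1 / u2) a b k h.
Proof.
move=> u10 u20.
case: e1; case: e2; case: h; case: k;
  rewrite !big_bool /= /lcorner !big_bool /= /bulk /rmat /lbdry /= ?(mulr0, mul0r, addr0, add0r) //;
  rewrite /sigma; field; do ?[apply/andP; split]; exact.
Qed.

(** Reflection equation on the right: the crossing turns back from the two rows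
    into the two columns above them. *)
Lemma refl_right (u1 u2 : K) (k h e2 e1 : bool) : u1 != 0 -> u2 != 0 ->
  \sum_(a : bool) \sum_(b : bool) rmat (u1 / u2) k h a b * rcorner u1 u2 a b e2 e1 =
  \sum_(a : bool) \sum_(b : bool) rmat (u1 / u2) e2 e1 a b * rcorner u2 u1 k h a b.
Proof.
move=> u10 u20.
case: e1; case: e2; case: h; case: k;
  rewrite !big_bool /= /rcorner !big_bool /= /bulk /rmat /rbdry /= ?(mulr0, mul0r, addr0, add0r) //;
  rewrite /sigma; field; do ?[apply/andP; split]; exact.
Qed.

End Local.

(** * The partition function, row by row *)

Section Triangle.
Variables (K : fieldType) (p q : K).

(** Sum over the states of one row with parameter [u] crossing columns with
    parameters [cs]: [s] lists the edges above the row (the last one belongs to the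
    right boundary vertex), [h] is the edge entering from the left, and [G] is the
    value of what lies below, as a function of the edges below the row.  Passing
    [G] as a continuation makes every sum range over [bool] only. *)
Fixpoint hline (u : K) (cs : seq K) (s : seq bool) (h : bool)
    (G : seq bool -> K) : K :=
  match cs, s with
  | [::], [:: a] => rbdry p q a h u * G [::]
  | c :: cs', a :: s' =>
      \sum_(b : bool) \sum_(k : bool)
        bulk q a b h k (u * c) * hline u cs' s' k (fun t => G (b :: t))
  | _, _ => 0
  end.

(** Partition function of the triangle whose lines carry [us], from the top row
    on, and whose middle column carries [p], with prescribed top edges [s].  The
    bottom edge of the middle column is free. *)
Fixpoint triangle (us : seq K) (s : seq bool) : K :=
  match us, s with
  | [::], _ => 1
  | u :: us', a :: s' =>
      \sum_(h : bool) lbdry p q a h u * hline u (us' ++ p :: rev us') s' h (triangle us')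
  | _, [::] => 0
  end.

(** A crossing put on top of the columns [k] and [k.+1]. *)
Fixpoint act_rmat (r : K) (k : nat) (G : seq bool -> K) (s : seq bool) : K :=
  match k, s with
  | 0, a :: b :: s' =>
      \sum_(a' : bool) \sum_(b' : bool) rmat q r a b a' b' * G (a' :: b' :: s')
  | k'.+1, a :: s' => act_rmat r k' (fun t => G (a :: t)) s'
  | _, _ => 0
  end.

Lemma eq_hline u cs s h G G' : G =1 G' -> hline u cs s h G = hline u cs s h G'.
Proof.
elim: cs s h G G' => [|c cs IH] [|a s] h G G' eG //=.
  by case: s => // ; rewrite eG.
apply: eq_bigr => b _; apply: eq_bigr => k _; congr (_ * _).
by apply: IH => t; apply: eG.
Qed.

Lemma hline_scale u cs s h a G :
  hline u cs s h (fun t => a * G t) = a * hline u cs s h G.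
Proof.
elim: cs s h G => [|c cs IH] [|e s] h G /=; rewrite ?mulr0 //.
  by case: s => [|? ?]; rewrite ?mulr0 // mulrCA.
rewrite mulr_sumr; apply: eq_bigr => b _.
rewrite mulr_sumr; apply: eq_bigr => k _.
by rewrite mulrCA -IH.
Qed.

Lemma hline_sum (I : finType) u cs s h (G : I -> seq bool -> K) :
  hline u cs s h (fun t => \sum_i G i t) = \sum_i hline u cs s h (G i).
Proof.
elim: cs s h G => [|c cs IH] [|e s] h G /=; rewrite ?big1_eq //.
  by case: s => [|? ?]; rewrite ?big1_eq // mulr_sumr.
rewrite [RHS]exchange_big; apply: eq_bigr => b _ /=.
rewrite [RHS]exchange_big; apply: eq_bigr => k _ /=.
by rewrite IH mulr_sumr.
Qed.

Lemma eq_act_rmat r k s G G' : G =1 G' -> act_rmat r k G s = act_rmat r k G' s.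
Proof.
elim: k s G G' => [|k IH] [|a s] G G' eG //=.
  case: s => // b s.
  by apply: eq_bigr => a1 _; apply: eq_bigr => b1 _; rewrite eG.
by apply: IH => t; apply: eG.
Qed.

Lemma act_rmat_scale r k s a G : act_rmat r k (fun t => a * G t) s = a * act_rmat r k G s.
Proof.
elim: k s G => [|k IH] [|e s] G /=; rewrite ?mulr0 //.
case: s => [|b s]; rewrite ?mulr0 //.
rewrite mulr_sumr; apply: eq_bigr => a' _.
rewrite mulr_sumr; apply: eq_bigr => b' _.
by rewrite mulrCA.
Qed.

Lemma act_rmat_sum (I : finType) r k s (G : I -> seq bool -> K) :
  act_rmat r k (fun t => \sum_i G i t) s = \sum_i act_rmat r k (G i) s.
Proof.
elim: k s G => [|k IH] [|e s] G /=; rewrite ?big1_eq //.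
case: s => [|b s]; rewrite ?big1_eq //.
rewrite [RHS]exchange_big; apply: eq_bigr => a' _ /=.
rewrite [RHS]exchange_big; apply: eq_bigr => b' _ /=.
by rewrite mulr_sumr.
Qed.

(** Rearrangement of sums that lets a local identity between two vertices and a
    crossing act in front of an arbitrary remainder [X]. *)
Lemma sum_ybe (R : bool -> bool -> K) (R' : bool -> bool -> bool -> bool -> K)
   (A : bool -> bool -> bool -> K) (B : bool -> bool -> bool -> bool -> K)
   (A' : bool -> bool -> K) (B' : bool -> bool -> bool -> K)
   (X : bool -> bool -> bool -> K) :
  (forall c d k, \sum_(a : bool) \sum_(b : bool) R a b *
        (\sum_(m : bool) A a c m * B b d m k) =
     \sum_(a : bool) \sum_(b : bool) (\sum_(m : bool) A' a m * B' b m k) * R' a b c d) ->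
  \sum_(a : bool) \sum_(b : bool) R a b *
     (\sum_(c : bool) \sum_(m : bool) A a c m *
        (\sum_(d : bool) \sum_(k : bool) B b d m k * X c d k)) =
  \sum_(c : bool) \sum_(m : bool) A' c m *
     (\sum_(d : bool) \sum_(k : bool) B' d m k *
        (\sum_(a : bool) \sum_(b : bool) R' c d a b * X a b k)).
Proof.
move=> H.
transitivity (\sum_(c : bool) \sum_(d : bool) \sum_(k : bool)
   (\sum_(a : bool) \sum_(b : bool) R a b *
        (\sum_(m : bool) A a c m * B b d m k)) * X c d k).
  by clear H; rewrite !big_bool /=; ring.
under eq_bigr => c _ do under eq_bigr => d _ do under eq_bigr => k _ do rewrite H.
by clear H; rewrite !big_bool /=; ring.
Qed.

Section Exchange.
Hypotheses (p0 : p != 0) (q0 : q != 0).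

Lemma act_rmat_hline u cs1 c1 c2 cs2 h G s :
    u != 0 -> c1 != 0 -> c2 != 0 ->
  act_rmat (c1 / c2) (size cs1) (fun t => hline u (cs1 ++ c1 :: c2 :: cs2) t h G) s =
  hline u (cs1 ++ c2 :: c1 :: cs2) s h (act_rmat (c1 / c2) (size cs1) G).
Proof.
move=> u0 c10 c20; elim: cs1 s h G => [|c cs1 IH] [|a s] h G //=.
  case: s => [|b s] /=.
    by symmetry; apply: big1 => x _; apply: big1 => y _; rewrite mulr0.
  have -> :
    \sum_(x : bool) \sum_(y : bool) bulk q a x h y (u * c2) *
      (\sum_(x0 : bool) \sum_(y0 : bool) bulk q b x0 y y0 (u * c1) *
         hline u cs2 s y0 (fun t => \sum_(a' : bool) \sum_(b' : bool)
            rmat q (c1 / c2) x x0 a' b' * G [:: a', b' & t])) =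
    \sum_(x : bool) \sum_(y : bool) bulk q a x h y (u * c2) *
      (\sum_(x0 : bool) \sum_(y0 : bool) bulk q b x0 y y0 (u * c1) *
         (\sum_(a' : bool) \sum_(b' : bool)
            rmat q (c1 / c2) x x0 a' b' * hline u cs2 s y0 (fun t => G [:: a', b' & t]))).
    apply: eq_bigr => x _; apply: eq_bigr => y _; congr (_ * _).
    apply: eq_bigr => x0 _; apply: eq_bigr => y0 _; congr (_ * _).
    rewrite hline_sum; apply: eq_bigr => a' _.
    by rewrite hline_sum; apply: eq_bigr => b' _; rewrite hline_scale.
  apply: (@sum_ybe _ _ (fun a' c m => bulk q a' c h m (u * c1))
     (fun b' d m k => bulk q b' d m k (u * c2)) _ _
     (fun c d k => hline u cs2 s k (fun t => G [:: c, d & t]))) => x y k.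
  exact: ybe_vert.
rewrite act_rmat_sum; apply: eq_bigr => b _.
rewrite act_rmat_sum; apply: eq_bigr => k _.
by rewrite act_rmat_scale IH.
Qed.

(** Two consecutive rows without their common left end; the first row also meets
    the column that belongs to the line of the second. *)
Definition hline_pair u1 u2 cs s k h G :=
  hline u1 (rcons cs u2) s k (fun t => hline u2 cs t h G).

Lemma hline_pair_nil u1 u2 a e k h G :
  hline_pair u1 u2 [::] [:: a; e] k h G = rcorner p q u1 u2 k h a e * G [::].
Proof. by rewrite /hline_pair /rcorner /= !big_bool /=; ring. Qed.

Lemma hline_pair_nil0 u1 u2 s k h G : size s != 2 -> hline_pair u1 u2 [::] s k h G = 0.
Proof.
by case: s => [|a [|b [|c s]]] //= _; rewrite /hline_pair /= !big_bool /=; ring.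
Qed.

Lemma hline_pair_cons u1 u2 c cs a s k h G :
  hline_pair u1 u2 (c :: cs) (a :: s) k h G =
  \sum_(d : bool) \sum_(k' : bool) \sum_(h' : bool)
    (\sum_(b : bool) bulk q a b k k' (u1 * c) * bulk q b d h h' (u2 * c)) *
    hline_pair u1 u2 cs s k' h' (fun t => G (d :: t)).
Proof.
rewrite {1}/hline_pair /=.
transitivity (\sum_(b : bool) \sum_(k' : bool) bulk q a b k k' (u1 * c) *
  \sum_(d : bool) \sum_(h' : bool) bulk q b d h h' (u2 * c) *
    hline_pair u1 u2 cs s k' h' (fun t => G (d :: t))).
  apply: eq_bigr => b _; apply: eq_bigr => k' _; congr (_ * _).
  rewrite hline_sum; apply: eq_bigr => d _.
  by rewrite hline_sum; apply: eq_bigr => h' _; rewrite hline_scale.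
by rewrite !big_bool /=; ring.
Qed.

(** The crossing of two rows travels to the right end and leaves upwards. *)
Lemma hline_pair_exchange u1 u2 cs s k h G :
    u1 != 0 -> u2 != 0 -> all (fun c => c != 0) cs ->
  \sum_(m : bool) \sum_(l : bool) rmat q (u1 / u2) k h m l * hline_pair u1 u2 cs s m l G =
  act_rmat (u1 / u2) (size cs) (fun t => hline_pair u2 u1 cs t k h G) s.
Proof.
move=> u10 u20; elim: cs s k h G => [|c cs IH] s k h G /=.
  move=> _; case: (altP (size s =P 2%N)).
    case: s => [|a [|e []]] //= _.
    transitivity ((\sum_(m : bool) \sum_(l : bool)
       rmat q (u1 / u2) k h m l * rcorner p q u1 u2 m l a e) * G [::]).
      by rewrite !big_bool /= !hline_pair_nil; ring.
    by rewrite refl_right // !big_bool /= !hline_pair_nil; ring.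
  move=> Hs; rewrite big1.
    case: s Hs => [|a [|e s]] //= Hs; rewrite big1 // => a' _; rewrite big1 // => b' _.
    by rewrite hline_pair_nil0 ?mulr0.
  by move=> m _; rewrite big1 // => l _; rewrite hline_pair_nil0 ?mulr0.
move=> /andP[c0 cs0]; case: s => [|a s].
  by rewrite big1 // => m _; rewrite big1 // => l _; rewrite /hline_pair /= mulr0.
transitivity (\sum_(d : bool) \sum_(k' : bool) \sum_(h' : bool)
  (\sum_(m : bool) \sum_(l : bool) rmat q (u1 / u2) k h m l *
     \sum_(b : bool) bulk q a b m k' (u1 * c) * bulk q b d l h' (u2 * c)) *
    hline_pair u1 u2 cs s k' h' (fun t => G (d :: t))).
  by under eq_bigr => m _ do under eq_bigr => l _ do rewrite hline_pair_cons;
    rewrite !big_bool /=; ring.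
transitivity (\sum_(d : bool) \sum_(m : bool) \sum_(l : bool)
  (\sum_(b : bool) bulk q a b k m (u2 * c) * bulk q b d h l (u1 * c)) *
  (\sum_(k' : bool) \sum_(h' : bool) rmat q (u1 / u2) m l k' h' *
     hline_pair u1 u2 cs s k' h' (fun t => G (d :: t)))).
  apply: eq_bigr => d _.
  under eq_bigr => k' _ do under eq_bigr => h' _ do rewrite ybe_horiz //.
  by rewrite !big_bool /=; ring.
rewrite (@eq_act_rmat _ _ _ _ (fun t => \sum_(d : bool) \sum_(m : bool) \sum_(l : bool)
  (\sum_(b : bool) bulk q a b k m (u2 * c) * bulk q b d h l (u1 * c)) *
   hline_pair u2 u1 cs t m l (fun t => G (d :: t)))); last by move=> t; rewrite hline_pair_cons.
rewrite act_rmat_sum; apply: eq_bigr => d _.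
rewrite act_rmat_sum; apply: eq_bigr => m _.
rewrite act_rmat_sum; apply: eq_bigr => l _.
by rewrite act_rmat_scale IH.
Qed.

End Exchange.
End Triangle.

(** * Symmetry in the parameters *)

Section Symmetry.
Variables (K : fieldType) (p q : K).
Hypotheses (p0 : p != 0) (q0 : q != 0).

Local Notation hline := (hline p q).
Local Notation triangle := (triangle p q).
Local Notation act_rmat := (act_rmat q).

Lemma triangle_two_rows u1 u2 us e1 e2 s :
  triangle (u1 :: u2 :: us) (e1 :: e2 :: s) =
  \sum_(k : bool) \sum_(h : bool) lcorner p q u1 u2 e1 e2 k h *
    hline_pair p q u1 u2 (us ++ p :: rev us) s k h (triangle us).
Proof.
rewrite /lcorner /hline_pair /= rev_cons -rcons_cons -rcons_cat.
transitivity (\sum_(h : bool) lbdry p q e1 h u1 *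
  (\sum_(b : bool) \sum_(k : bool) bulk q e2 b h k (u1 * u2) *
    (\sum_(l : bool) lbdry p q b l u2 * hline u1 (rcons (us ++ p :: rev us) u2) s k
      (fun t => hline u2 (us ++ p :: rev us) t l (triangle us))))).
  apply: eq_bigr => h _; congr (_ * _).
  apply: eq_bigr => b _; apply: eq_bigr => k _; congr (_ * _).
  by rewrite hline_sum; apply: eq_bigr => l _; rewrite hline_scale.
by rewrite !big_bool /=; ring.
Qed.

(** The crossing enters on top of the left columns of the lines [u1] and [u2],
    descends through the rows above these lines, passes along them, and climbs
    back on the right.  The position of the right columns counts the [size us0]
    outer columns, the [2 * size us + 1] inner ones and the two left columns. *)
Lemma triangle_exchange us0 u1 u2 us s :
    all (fun c => c != 0) (us0 ++ u1 :: u2 :: us) ->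
  act_rmat (u1 / u2) (size us0) (triangle (us0 ++ u1 :: u2 :: us)) s =
  act_rmat (u1 / u2) (size us0 + (2 * size us + 3)) (triangle (us0 ++ u2 :: u1 :: us)) s.
Proof.
elim: us0 s => [|v us0 IH] s.
  rewrite [size [::]]/= add0n cat0s => /= /and3P[u10 u20 us0].
  have -> : (2 * size us + 3 = (size (us ++ p :: rev us)).+2)%N.
    by rewrite size_cat /= size_rev; lia.
  case: s => [|e1 [|e2 s]] //.
  have cs0 : all (fun c => c != 0) (us ++ p :: rev us).
    by rewrite all_cat /= p0 all_rev us0.
  transitivity (\sum_(k : bool) \sum_(h : bool)
    (\sum_(a : bool) \sum_(b : bool) rmat q (u1 / u2) e1 e2 a b *
      lcorner p q u1 u2 a b k h) *
      hline_pair p q u1 u2 (us ++ p :: rev us) s k h (triangle us)).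
    transitivity (\sum_(a : bool) \sum_(b : bool) rmat q (u1 / u2) e1 e2 a b *
      triangle (u1 :: u2 :: us) (a :: b :: s)); first by [].
    under eq_bigr => a _ do under eq_bigr => b _ do rewrite triangle_two_rows.
    by rewrite !big_bool /=; ring.
  under eq_bigr => k _ do under eq_bigr => h _ do rewrite refl_left //.
  transitivity (\sum_(k : bool) \sum_(h : bool) lcorner p q u2 u1 e1 e2 k h *
     (\sum_(a : bool) \sum_(b : bool) rmat q (u1 / u2) k h a b *
      hline_pair p q u1 u2 (us ++ p :: rev us) s a b (triangle us))).
    by rewrite !big_bool /=; ring.
  transitivity (act_rmat (u1 / u2) (size (us ++ p :: rev us)) (fun t =>
     \sum_(k : bool) \sum_(h : bool) lcorner p q u2 u1 e1 e2 k h *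
      hline_pair p q u2 u1 (us ++ p :: rev us) t k h (triangle us)) s); last first.
    transitivity (act_rmat (u1 / u2) (size (us ++ p :: rev us)) (fun t =>
      triangle (u2 :: u1 :: us) (e1 :: e2 :: t)) s); last by [].
    by apply: eq_act_rmat => t; rewrite triangle_two_rows.
  rewrite act_rmat_sum; apply: eq_bigr => k _.
  rewrite act_rmat_sum; apply: eq_bigr => h _.
  by rewrite act_rmat_scale hline_pair_exchange.
rewrite [all _ _]/= => /andP[v0 a0]; case: s => [|a s] //.
have /and3P[u10 u20 _] : [&& u1 != 0, u2 != 0 & all (fun c => c != 0) us].
  by move: a0; rewrite all_cat /= => /andP[].
rewrite [LHS]/= [RHS]/= act_rmat_sum [RHS]act_rmat_sum.
apply: eq_bigr => h _; rewrite act_rmat_scale [RHS]act_rmat_scale; congr (_ * _).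
rewrite -catA [in LHS]/= act_rmat_hline //.
rewrite (eq_hline _ _ _ _ _ _ (IH^~ a0)).
have E w1 w2 : (us0 ++ w1 :: w2 :: us) ++ p :: rev (us0 ++ w1 :: w2 :: us) =
  (us0 ++ w1 :: w2 :: us ++ p :: rev us) ++ w2 :: w1 :: rev us0.
  by rewrite rev_cat !rev_cons -!cats1 -!catA /= -!catA.
have Es w1 w2 : (size us0 + (2 * size us + 3))%N =
  size (us0 ++ w1 :: w2 :: us ++ p :: rev us).
  by rewrite !size_cat /= size_cat /= size_rev; lia.
rewrite [in RHS]E (Es u2 u1) act_rmat_hline //; congr hline.
by rewrite rev_cat !rev_cons -!cats1 -!catA /= -!catA.
Qed.

Definition up_top (us : seq K) := nseq (2 * size us).+1 true.
Definition triangle_up (us : seq K) := triangle us (up_top us).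

Lemma act_rmat_up r k m G : (k.+1 < m)%N ->
  act_rmat r k G (nseq m true) = sigma (q ^+ 4 / r) * G (nseq m true).
Proof.
elim: k m G => [|k IH] [|m] G //.
  by case: m => [|m] // _; rewrite /= !big_bool /= /rmat /= !mul0r !addr0.
by rewrite ltnS => km /=; rewrite IH.
Qed.

(** With all top edges up, the crossing acts by the scalar [sigma (q ^+ 4 * (u2 / u1))]
    on both sides, and can be cancelled. *)
Lemma triangle_up_swap us0 u1 u2 us :
    all (fun c => c != 0) (us0 ++ u1 :: u2 :: us) ->
    sigma (q ^+ 4 * (u2 / u1)) != 0 ->
  triangle_up (us0 ++ u1 :: u2 :: us) = triangle_up (us0 ++ u2 :: u1 :: us).
Proof.
move=> a0 s0.
have := triangle_exchange (up_top (us0 ++ u1 :: u2 :: us)) a0.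
rewrite !act_rmat_up; try by rewrite size_cat /=; lia.
rewrite invf_div => /(mulfI s0).
by rewrite /triangle_up /up_top !size_cat /=.
Qed.

Lemma triangle_up_move us0 us x us1 :
    all (fun c => c != 0) (us0 ++ us ++ x :: us1) ->
    all (fun u => (sigma (q ^+ 4 * (x / u)) != 0) || (sigma (q ^+ 4 * (u / x)) != 0))
      us ->
  triangle_up (us0 ++ us ++ x :: us1) = triangle_up (us0 ++ x :: us ++ us1).
Proof.
elim: us us0 => [|u us IH] us0 //= a0 /andP[xu xus].
rewrite -cat1s catA IH ?catA -?catA //=.
move: a0; rewrite all_cat /= all_cat /= => /and5P[a0 u0 a1 x0 a2].
case/orP: xu => xu; first by rewrite triangle_up_swap // !all_cat /= u0 x0 a0 all_cat a1 a2.
by rewrite [RHS]triangle_up_swap // !all_cat /= u0 x0 a0 all_cat a1 a2.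
Qed.

End Symmetry.

(** * Frozen rows *)

Section Freezing.
Variables (K : fieldType) (p q : K).
Hypotheses (p0 : p != 0) (q0 : q != 0).

Local Notation hline := (hline p q).
Local Notation triangle := (triangle p q).
Local Notation triangle_up := (triangle_up p q).

Lemma sum_bool (F : bool -> K) : \sum_(b : bool) F b = F true + F false.
Proof. by rewrite big_bool. Qed.

Lemma rcons_nseq (T : Type) m (a : T) : rcons (nseq m a) a = nseq m.+1 a.
Proof. by elim: m => //= m ->. Qed.

(** A left-pointing edge freezes the rest of the row: the next vertex has its upper
    and its left edge outgoing, so the other two are incoming, and so on. *)
Lemma hline_left u cs e G :
  hline u cs (rcons (nseq (size cs) true) e) false G =
  (\prod_(c <- cs) sigma (q ^+ 2 / (u * c))) * rbdry p q e false u *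
    G (nseq (size cs) true).
Proof.
elim: cs G => [|c cs IH] G /=; first by rewrite big_nil mul1r.
rewrite !big_bool /= /bulk /= !mul0r add0r addr0 IH big_cons.
by ring.
Qed.

(** The last top edge is summed with weights [alpha].  If the row turns left
    anywhere it is frozen from there on, and the hypothesis says that these
    contributions cancel in the sum; so the row runs right up to its end. *)
Lemma hline_right u cs (alpha : bool -> K) G :
    \sum_(e : bool) alpha e * rbdry p q e false u = 0 ->
  \sum_(e : bool) alpha e * hline u cs (rcons (nseq (size cs) true) e) true G =
  alpha true * sigma (u / p) * (\prod_(c <- cs) sigma (q ^+ 2 * (u * c))) *
    G (nseq (size cs) true).
Proof.
move=> a0; elim: cs G => [|c cs IH] G /=.
  by rewrite big_nil big_bool /= /rbdry /=; ring.
transitivity (sigma (q ^+ 2 * (u * c)) *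
   (\sum_(e : bool) alpha e * hline u cs (rcons (nseq (size cs) true) e) true
     (fun t => G (true :: t))) +
   sigma (q ^+ 4) * (\prod_(c <- cs) sigma (q ^+ 2 / (u * c))) *
   (\sum_(e : bool) alpha e * rbdry p q e false u) *
   G (false :: nseq (size cs) true)).
  by rewrite !big_bool /= !hline_left /bulk /=; ring.
by rewrite a0 IH big_cons /=; ring.
Qed.

(** A row that turns left before its last bulk vertex would cross that vertex
    with weight zero. *)
Lemma hline_right_blocked u cs c G : sigma (q ^+ 2 / (u * c)) = 0 ->
  hline u (rcons cs c) (nseq (size cs).+2 true) true G =
  (\prod_(c <- cs) sigma (q ^+ 2 * (u * c))) *
    hline u [:: c] [:: true; true] true (fun t => G (nseq (size cs) true ++ t)).
Proof.
move=> c0; elim: cs G => [|c1 cs IH] G; first by rewrite big_nil mul1r.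
have F G' : hline u (rcons cs c) (nseq (size cs).+2 true) false G' = 0.
  by rewrite -rcons_nseq -(size_rcons cs c) hline_left big_rcons /= c0 !(mulr0, mul0r).
transitivity (sigma (q ^+ 2 * (u * c1)) * hline u (rcons cs c) (nseq (size cs).+2 true)
    true (fun t => G (true :: t)) +
  sigma (q ^+ 4) * hline u (rcons cs c) (nseq (size cs).+2 true)
    false (fun t => G (false :: t))).
  by rewrite [LHS]/= !big_bool /bulk /=; ring.
by rewrite F IH big_cons /=; ring.
Qed.

Definition cols (us : seq K) := us ++ p :: rev us.

Lemma triangle_up_cons u us : triangle_up (u :: us) =
  \sum_(h : bool) lbdry p q true h u *
    hline u (cols us) (nseq (size (cols us)).+1 true) h (triangle us).
Proof.
have E : (2 * size (u :: us)).+1 = (size (cols us)).+2.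
  by rewrite /cols size_cat /= size_rev; lia.
by rewrite /triangle_up /up_top E.
Qed.

Lemma size_cols us : size (cols us) = (2 * size us).+1.
Proof. by rewrite /cols size_cat /= size_rev addnS addnn mul2n. Qed.

Lemma triangle_upE us : triangle us (nseq (size (cols us)) true) = triangle_up us.
Proof. by rewrite size_cols. Qed.

Lemma cols_cons u us : cols (u :: us) = u :: rcons (cols us) u.
Proof. by rewrite /cols rev_cons /= -rcons_cons -rcons_cat. Qed.

(** The left boundary vertex cannot have two outgoing edges, so the top row is
    entirely left-pointing. *)
Lemma triangle_up_self u us : u != 0 -> sigma (q ^+ 2 * u ^+ 2) = 0 ->
  triangle_up (u :: us) =
  sigma (p / u) * (\prod_(c <- cols us) sigma (q ^+ 2 / (u * c))) *
    sigma (q ^+ 2 / u ^+ 2) * triangle_up us.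
Proof.
move=> u0 s0; rewrite triangle_up_cons sum_bool /lbdry s0 mul0r add0r.
by rewrite -rcons_nseq hline_left triangle_upE /rbdry !mulrA.
Qed.

Lemma hline_leftT u cs m G : m = (size cs).+1 ->
  hline u cs (nseq m true) false G =
  (\prod_(c <- cs) sigma (q ^+ 2 / (u * c))) * sigma (q ^+ 2 / u ^+ 2) *
    G (nseq (size cs) true).
Proof. by move=> ->; rewrite -rcons_nseq hline_left. Qed.

(** At the left crossing of the two lines the vertex with all edges pointing up or
    right has weight zero, so the next edge of the first row points left and the
    row is frozen from there on.  In the corner the contributions with a
    right-pointing second row cancel, which freezes this row as well. *)
Lemma triangle_up_pair_left (u1 u2 : K) us : u1 != 0 -> u2 != 0 -> u1 * u2 = q ^- 2 ->
  triangle_up (u1 :: u2 :: us) =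
  sigma (p / u1) * sigma (p / u2) * sigma (q ^+ 4) ^+ 2 *
  sigma (q ^+ 2 / u1 ^+ 2) * sigma (q ^+ 2 / u2 ^+ 2) *
  (\prod_(c <- cols us) (sigma (q ^+ 2 / (u1 * c)) * sigma (q ^+ 2 / (u2 * c)))) *
  triangle_up us.
Proof.
move=> u10 u20 u12.
have u12q : q ^+ 2 / (u1 * u2) = q ^+ 4 by rewrite u12 invrK -exprD.
have s12 : sigma (q ^+ 2 * (u1 * u2)) = 0.
  by rewrite u12 divff ?expf_neq0 // /sigma invr1 subrr.
transitivity (sigma (q ^+ 4) *
   ((\prod_(c <- cols us) sigma (q ^+ 2 / (u1 * c))) * sigma (q ^+ 4)
    * sigma (q ^+ 2 / u1 ^+ 2)) *
   (\sum_(h : bool) lbdry p q true h u1 *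
     (\sum_(k : bool) lbdry p q (~~ h) k u2 *
      hline u2 (cols us) (nseq (size (cols us)).+1 true) k (triangle us)))).
  rewrite triangle_up_cons cols_cons.
  rewrite [size _]/= size_rcons /= !sum_bool.
  rewrite !(hline_leftT _ _ (m := (size (cols us)).+2)) ?size_rcons // big_rcons /=.
  rewrite ?sum_bool /bulk /= s12 u12q.
  by rewrite -/(cols us) !mul0r !(add0r, addr0); ring.
rewrite !sum_bool !hline_leftT // triangle_upE.
have E : sigma (p / u1) * sigma (q ^+ 2 * u2 ^+ 2) +
    sigma (q ^+ 2 * u1 ^+ 2) * sigma (p * q ^+ 2 * u2) = 0.
  have -> : u2 = q ^- 2 / u1 by rewrite -u12 mulrC mulKf.
  by rewrite /sigma; field; rewrite p0 q0 u10 ?oner_neq0.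
rewrite /= big_split /=; move/eqP: E; rewrite addr_eq0 => /eqP E.
set A := sigma (p / u1) in E *; set B := sigma (q ^+ 2 * u2 ^+ 2) in E *.
set C := sigma (q ^+ 2 * u1 ^+ 2) in E *; set D := sigma (p * q ^+ 2 * u2) in E *.
ring: E.
Qed.

(** Mirror situation: left-pointing rows have weight zero at the right crossing,
    or cancel at the right end. *)
Lemma triangle_up_pair_right (u1 u2 : K) us : u1 != 0 -> u2 != 0 -> u1 * u2 = q ^+ 2 ->
  triangle_up (u1 :: u2 :: us) =
  sigma (u1 / p) * sigma (u2 / p) * sigma (q ^+ 4) ^+ 2 *
  sigma (q ^+ 2 * u1 ^+ 2) * sigma (q ^+ 2 * u2 ^+ 2) *
  (\prod_(c <- cols us) (sigma (q ^+ 2 * (u1 * c)) * sigma (q ^+ 2 * (u2 * c)))) *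
  triangle_up us.
Proof.
move=> u10 u20 u12.
have u12q : q ^+ 2 * (u1 * u2) = q ^+ 4 by rewrite u12 -exprD.
have s12 : sigma (q ^+ 2 / (u1 * u2)) = 0.
  by rewrite u12 divff ?expf_neq0 // /sigma invr1 subrr.
pose alpha (e : bool) := if e then sigma (u1 / p) else sigma (q ^+ 2 / u1 ^+ 2).
have E : \sum_(e : bool) alpha e * rbdry p q e false u2 = 0.
  rewrite big_bool /alpha /= /rbdry.
  have -> : u2 = q ^+ 2 / u1 by rewrite -u12 mulrC mulKf.
  by rewrite /sigma; field; rewrite p0 q0 u10 ?oner_neq0.
transitivity (sigma (q ^+ 2 * u1 ^+ 2) * sigma (q ^+ 4) ^+ 2 *
  (\prod_(c <- cols us) sigma (q ^+ 2 * (u1 * c))) *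
  (\sum_(h : bool) lbdry p q true h u2 *
   \sum_(e : bool) alpha e *
     hline u2 (cols us) (rcons (nseq (size (cols us)) true) e) h (triangle us))).
  have F G : hline u1 (rcons (cols us) u2) (nseq (size (cols us)).+2 true) false G = 0.
    rewrite hline_leftT ?size_rcons // big_rcons /= s12.
    by rewrite !(mul0r, mulr0).
  have L G : hline u1 [:: u2] [:: true; true] true G =
      sigma (q ^+ 4) * \sum_(e : bool) alpha e * G [:: e].
    by rewrite /= !sum_bool /= /bulk /alpha /= /rbdry u12q; ring.
  rewrite triangle_up_cons cols_cons sum_bool /= size_rcons.
  rewrite -[true :: true :: nseq _ _]/(nseq (size (cols us)).+2 true).
  rewrite !sum_bool /= !F /bulk /= s12 u12q.
  rewrite -[true :: true :: nseq _ _]/(nseq (size (cols us)).+2 true).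
  rewrite hline_right_blocked // L !sum_bool /= !cats1 -!/(cols us).
  by rewrite !mul0r !mulr0 !addr0; ring.
rewrite [X in _ * X]sum_bool hline_right //.
transitivity (sigma (q ^+ 2 * u1 ^+ 2) * sigma (q ^+ 4) ^+ 2 *
  \prod_(c <- cols us) sigma (q ^+ 2 * (u1 * c)) *
  (lbdry p q true true u2 *
   (alpha true * sigma (u2 / p) * \prod_(c <- cols us) sigma (q ^+ 2 * (u2 * c)) *
    triangle (us) (nseq (size (cols us)) true)) +
   lbdry p q true false u2 * (\prod_(c <- cols us) sigma (q ^+ 2 / (u2 * c))) *
     triangle us (nseq (size (cols us)) true) *
     (\sum_(e : bool) alpha e * rbdry p q e false u2))).
  by rewrite !sum_bool !hline_left; ring.
by rewrite E triangle_upE big_split /lbdry /alpha /=; ring.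
Qed.
End Freezing.

(** * Laurent polynomials of fixed parity *)

Section Laurent.
Variables (K : fieldType).

(** Laurent polynomials with exponents in [- d, - d + 2, ..., d].  The fixed parity
    halves the number of roots needed in an interpolation. *)
Definition laurent (d : nat) (f : K -> K) : Prop :=
  exists2 P : {poly K}, (size P <= d.+1)%N &
    forall x, x != 0 -> f x * x ^+ d = P.[x ^+ 2].

Lemma eq_laurent d f g : (forall x, x != 0 -> f x = g x) -> laurent d g -> laurent d f.
Proof. by move=> e [P sP gP]; exists P => // x x0; rewrite e ?gP. Qed.

Lemma laurent_const c : laurent 0 (fun=> c).
Proof.
exists c%:P; first by rewrite size_polyC; case: eqP.
by move=> x _; rewrite hornerC mulr1.
Qed.

Lemma laurentD d f g : laurent d f -> laurent d g -> laurent d (fun x => f x + g x).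
Proof.
move=> [P sP fP] [Q sQ gQ]; exists (P + Q).
  by rewrite (leq_trans (size_polyD _ _)) // geq_max sP.
by move=> x x0; rewrite hornerD mulrDl fP ?gQ.
Qed.

Lemma laurentM d e f g : laurent d f -> laurent e g -> laurent (d + e) (fun x => f x * g x).
Proof.
move=> [P sP fP] [Q sQ gQ]; exists (P * Q).
  have := size_polyMleq P Q; lia.
by move=> x x0; rewrite hornerM -fP // -gQ // exprD; ring.
Qed.

Lemma laurent_up d f : laurent d f -> laurent d.+2 f.
Proof.
move=> [P sP fP]; exists (P * 'X).
  by have := size_polyMleq P 'X; rewrite size_polyX; lia.
by move=> x x0; rewrite hornerMX -fP // -addn2 exprD mulrA.
Qed.

(** Only a change of [d] by an even number preserves the parity of the exponents. *)
Lemma laurent_le e d f : laurent d f -> (d <= e)%N -> ~~ odd (e - d) -> laurent e f.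
Proof.
move=> lf de; have [k ->] : exists k, e = (d + k)%N by exists (e - d)%N; lia.
rewrite addKn => ek; have [m ->] : exists m, k = (2 * m)%N by exists k./2; lia.
elim: m => [|m IH]; first by rewrite muln0 addn0.
have -> : (d + 2 * m.+1 = (d + 2 * m).+2)%N by lia.
exact: laurent_up IH.
Qed.

Lemma laurent0 d : laurent d (fun=> 0).
Proof. by exists 0; rewrite ?size_poly0 // => x _; rewrite horner0 mul0r. Qed.

Lemma laurent_sum (I : Type) (r : seq I) d (f : I -> K -> K) :
  (forall i, laurent d (f i)) -> laurent d (fun x => \sum_(i <- r) f i x).
Proof.
move=> lf; elim: r => [|i r IH].
  by apply: eq_laurent (laurent0 d) => x _; rewrite big_nil.
by apply: eq_laurent (laurentD (lf i) IH) => x _; rewrite big_cons.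
Qed.

Lemma laurent_prod (I : Type) (r : seq I) (P : pred I) (d : I -> nat) (f : I -> K -> K) :
  (forall i, laurent (d i) (f i)) ->
  laurent (\sum_(i <- r | P i) d i) (fun x => \prod_(i <- r | P i) f i x).
Proof.
move=> lf; elim: r => [|i r IH].
  by rewrite big_nil; apply: eq_laurent (laurent_const 1) => x _; rewrite big_nil.
rewrite big_cons; case Pi: (P i); last first.
  by apply: eq_laurent IH => x _; rewrite big_cons Pi.
by apply: eq_laurent (laurentM (lf i) IH) => x _; rewrite big_cons Pi.
Qed.

Lemma laurentZ d c f : laurent d f -> laurent d (fun x => c * f x).
Proof. exact: (laurentM (laurent_const c)). Qed.

Lemma size_lin (a b : K) : (size (a *: 'X + b%:P)%R <= 2)%N.
Proof.
rewrite (leq_trans (size_polyD _ _)) // geq_max.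
rewrite (leq_trans (size_scale_leq _ _)) ?size_polyX //=.
by rewrite size_polyC; case: eqP.
Qed.

Lemma laurent_sigmaM a : laurent 1 (fun x => sigma (a * x)).
Proof.
exists (a *: 'X + (- a^-1)%:P); first exact: size_lin.
move=> x x0; rewrite hornerD hornerZ hornerX hornerC /sigma invfM expr1.
by rewrite mulrBl mulfVK //; ring.
Qed.

Lemma laurent_sigmaV a : laurent 1 (fun x => sigma (a / x)).
Proof.
apply: eq_laurent (laurentZ (-1) (laurent_sigmaM a^-1)) => x x0.
by rewrite /sigma !invfM !invrK; ring.
Qed.

Lemma laurent_sigma2 a : laurent 2 (fun x => sigma (a * x ^+ 2)).
Proof.
exists (a *: 'X^2 + (- a^-1)%:P).
  rewrite (leq_trans (size_polyD _ _)) // geq_max.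
  rewrite (leq_trans (size_scale_leq _ _)) ?size_polyXn //=.
  by rewrite size_polyC; case: eqP.
move=> x x0; rewrite hornerD hornerZ hornerXn hornerC /sigma invfM.
by rewrite mulrBl mulfVK ?expf_neq0 //; ring.
Qed.

Lemma laurent_sigmaV2 a : laurent 2 (fun x => sigma (a / x ^+ 2)).
Proof.
apply: eq_laurent (laurentZ (-1) (laurent_sigma2 a^-1)) => x x0.
by rewrite /sigma !invfM !invrK; ring.
Qed.

(** Laurent polynomials in [x ^+ 2] of unspecified degree. *)
Definition even_laurent (f : K -> K) : Prop := exists d, laurent (2 * d) f.

Lemma even_laurent_const c : even_laurent (fun=> c).
Proof. by exists 0%N; apply: laurent_const. Qed.

Lemma even_laurentM f g : even_laurent f -> even_laurent g -> even_laurent (fun x => f x * g x).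
Proof. by move=> [d lf] [e lg]; exists (d + e)%N; rewrite mulnDr; apply: laurentM. Qed.

Lemma even_laurentD f g : even_laurent f -> even_laurent g -> even_laurent (fun x => f x + g x).
Proof.
move=> [d lf] [e lg]; exists (d + e)%N.
by apply: laurentD; [apply: laurent_le lf _ _ | apply: laurent_le lg _ _]; lia.
Qed.

Lemma even_laurentB f g : even_laurent f -> even_laurent g -> even_laurent (fun x => f x - g x).
Proof.
move=> ef eg; apply: even_laurentD => //; have := even_laurentM (even_laurent_const (-1)) eg.
by move=> [d l]; exists d; apply: eq_laurent l => x _; rewrite mulN1r.
Qed.

Lemma even_laurent_prod (I : Type) (r : seq I) (P : pred I) (f : I -> K -> K) :
  (forall i, even_laurent (f i)) -> even_laurent (fun x => \prod_(i <- r | P i) f i x).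
Proof.
move=> ef; elim: r => [|i r [d IH]].
  by exists 0%N; apply: eq_laurent (laurent_const 1) => x _; rewrite big_nil.
case Pi: (P i); last by exists d; apply: eq_laurent IH => x _; rewrite big_cons Pi.
have [e l] := even_laurentM (ef i) (ex_intro _ d IH).
by exists e; apply: eq_laurent l => x _; rewrite big_cons Pi.
Qed.

Lemma even_laurent_sum (I : Type) (r : seq I) (P : pred I) (f : I -> K -> K) :
  (forall i, even_laurent (f i)) -> even_laurent (fun x => \sum_(i <- r | P i) f i x).
Proof.
move=> ef; elim: r => [|i r [d IH]].
  by exists 0%N; apply: eq_laurent (laurent_const 0) => x _; rewrite big_nil.
case Pi: (P i); last by exists d; apply: eq_laurent IH => x _; rewrite big_cons Pi.
have [e l] := even_laurentD (ef i) (ex_intro _ d IH).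
by exists e; apply: eq_laurent l => x _; rewrite big_cons Pi.
Qed.

Lemma even_laurent_det n (A : K -> 'M[K]_n) :
  (forall i k, even_laurent (fun x => A x i k)) -> even_laurent (fun x => \det (A x)).
Proof.
move=> eA; rewrite /determinant; apply: even_laurent_sum => s.
by apply: even_laurentM; [apply: even_laurent_const | apply: even_laurent_prod].
Qed.

(** The factor [x ^+ 2 - u ^+ 2] is used instead of [sigma (x / u)] because it
    stays within the Laurent polynomials in [x ^+ 2]. *)
Lemma even_laurent_root f u : even_laurent f -> u != 0 -> f u = 0 ->
  exists2 g, even_laurent g & forall x, x != 0 -> f x = (x ^+ 2 - u ^+ 2) * g x.
Proof.
move=> [d [P sP fP]] u0 fu.
have /factor_theorem[Q PQ] : root P (u ^+ 2) by rewrite /root -fP // fu mul0r.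
exists (fun x => Q.[x ^+ 2] / x ^+ (2 * d)).
  exists d; exists Q => [|x x0]; last by rewrite mulfVK ?expf_neq0.
  have [->|Q0] := eqVneq Q 0; first by rewrite size_poly0.
  by move: sP; rewrite PQ size_Mmonic ?monicXsubC // size_XsubC; lia.
move=> x x0; have := fP x x0; rewrite PQ hornerM hornerXsubC => E.
by rewrite mulrA [_ * Q.[_]]mulrC -E mulfK ?expf_neq0.
Qed.

End Laurent.

(** * Degree of the partition function and its zeros *)

Section Bound.
Variables (K : fieldType) (p q : K).
Hypotheses (p0 : p != 0) (q0 : q != 0).

Local Notation hline := (hline p q).
Local Notation triangle := (triangle p q).
Local Notation triangle_up := (triangle_up p q).

Lemma laurent_lbdry up right :
  laurent (1 + (up && right)) (fun x => lbdry p q up right x).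
Proof.
case: up; case: right; rewrite /lbdry /=.
- exact: laurent_sigma2.
- exact: laurent_sigmaV.
- exact: laurent_sigmaM.
- exact: laurent0.
Qed.

Lemma laurent_rbdry up left :
  laurent (1 + (up && ~~ left)) (fun x => rbdry p q up left x).
Proof.
case: up; case: left; rewrite /rbdry /=.
- by apply: eq_laurent (laurent_sigmaM p^-1) => x _; rewrite mulrC.
- exact: laurent_sigmaV2.
- exact: laurent0.
- by apply: eq_laurent (laurent_sigmaV (q ^+ 2 / p)) => x _; rewrite invfM mulrA.
Qed.

Lemma laurent_bulk up down left right c :
  laurent (up == down) (fun x => bulk q up down left right (c * x)).
Proof.
rewrite /bulk; case: (up == down); last first.
  by case: ifP => _; [apply: laurent_const | apply: laurent0].
case: (left == right); last exact: laurent0.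
case: (up == left).
  by apply: eq_laurent (laurent_sigmaM (q ^+ 2 * c)) => x _; rewrite mulrA.
by apply: eq_laurent (laurent_sigmaV (q ^+ 2 / c)) => x _; rewrite invfM mulrA.
Qed.

(** The three vertices of the bottom row, with the free edge below the middle one. *)
Definition bottom x eL eM eR : K := triangle [:: x] [:: eL; eM; eR].

Lemma bottomE x eL eM eR : bottom x eL eM eR =
  \sum_(h : bool) lbdry p q eL h x * \sum_(b : bool) \sum_(k : bool)
    bulk q eM b h k (x * p) * (rbdry p q eR k x).
Proof.
rewrite /bottom /=; apply: eq_bigr => h _; congr (_ * _).
by apply: eq_bigr => b _; apply: eq_bigr => k _; rewrite mulr1.
Qed.

(** For a single line this is the theorem, and the origin of the factor
    attached to each line. *)
Lemma bottom_up x : x != 0 ->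
  bottom x true true true =
  sigma (q ^+ 4) * sigma (q ^+ 2 * p * x) * sigma (q ^+ 2 / (p * x)).
Proof.
move=> x0; rewrite bottomE !big_bool /= /bulk /rbdry /=.
by rewrite /sigma; field; rewrite ?p0 ?q0 ?x0 ?oner_neq0.
Qed.

(** The cancellation that depends on the middle column carrying the parameter [p]
    of the boundary weights; the two largest summands have degree [4] in [x]. *)
Lemma bottom_down x : x != 0 -> bottom x true false true = 0.
Proof.
move=> x0; rewrite bottomE !big_bool /= /bulk /rbdry /=.
by rewrite /sigma; field; rewrite ?p0 ?q0 ?x0 ?oner_neq0.
Qed.

(** When both outer edges point up, the bound [2] is one of the two preceding
    lemmas; in the other cases the bound holds for each summand. *)
Lemma laurent_bottom eL eM eR :
  laurent (2 + ~~ eL + ~~ eR) (fun x => bottom x eL eM eR).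
Proof.
have [/andP[/eqP-> /eqP->]|nup] := boolP ((eL == true) && (eR == true)).
  case: eM; last by apply: eq_laurent (laurent0 K _) => x; apply: bottom_down.
  apply: eq_laurent (laurentZ (sigma (q ^+ 4))
    (laurentM (laurent_sigmaM (q ^+ 2 * p)) (laurent_sigmaV (q ^+ 2 / p)))) => x x0.
  by rewrite bottom_up // invfM !mulrA.
apply: (@eq_laurent _ _ _ (fun x => \sum_(h : bool) \sum_(b : bool) \sum_(k : bool)
   lbdry p q eL h x * bulk q eM b h k (x * p) * rbdry p q eR k x)).
  by move=> x _; rewrite bottomE !big_bool /=; ring.
apply: laurent_sum => h; apply: laurent_sum => b; apply: laurent_sum => k.
have := laurentM (laurentM (laurent_lbdry eL h) (laurent_bulk eM b h k p)) (laurent_rbdry eR k).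
set d := (_ + _)%N => Hd.
have {}Hd : laurent d (fun x => lbdry p q eL h x * bulk q eM b h k (x * p) * rbdry p q eR k x).
  by apply: eq_laurent Hd => x _; rewrite (mulrC x).
move: nup Hd; rewrite /d {d}.
case: eL; case: eR => // _; case: h; case: k; case: b; case: eM => /= Hd;
 try (apply: laurent_le Hd _ _; exact: isT); by apply: eq_laurent (laurent0 K _) => x _;
   rewrite /bulk /= ?(mulr0, mul0r).
Qed.

Lemma laurent_hline_const u cs s h d (G : K -> seq bool -> K) :
    (forall t, laurent d (G^~ t)) ->
  laurent d (fun x => hline u cs s h (G x)).
Proof.
elim: cs s h G => [|c cs IH] [|a s] h G lG /=; try exact: laurent0.
  case: s => [|b s]; last exact: laurent0.
  by apply: laurentZ; apply: lG.
apply: laurent_sum => b; apply: laurent_sum => k; apply: laurentZ.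
by apply: IH => t; apply: lG.
Qed.

(** A straight crossing costs one degree in [x].  A turn costs none and changes the
    state of the column, so counting [1] for an edge that points down makes the
    bound the same in all cases. *)
Lemma laurent_hline_var u cs s a h d (G : K -> seq bool -> K) :
    (forall b k, laurent (d + ~~ b) (fun x => hline u (cs x) s k (fun t => G x (b :: t)))) ->
  laurent (d.+1 + ~~ a) (fun x => hline u (x :: cs x) (a :: s) h (G x)).
Proof.
move=> lG; apply: laurent_sum => b; apply: laurent_sum => k.
have := laurentM (laurent_bulk a b h k u) (lG b k).
by case: a; case: b; rewrite ?addn0 ?addn1 ?add0n //= => /laurent_le; apply; lia.
Qed.

Lemma laurent_hline_fix u c cs s a h d (G : K -> seq bool -> K) :
    (forall b k, laurent d (fun x => hline u (cs x) s k (fun t => G x (b :: t)))) ->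
  laurent d (fun x => hline u (c :: cs x) (a :: s) h (G x)).
Proof.
by move=> lG; apply: laurent_sum => b; apply: laurent_sum => k; apply: laurentZ.
Qed.

Lemma laurent_hline_cat u cs1 cs s1 s h d (G : K -> seq bool -> K) :
    size s1 = size cs1 ->
    (forall t1 k, size t1 = size s1 ->
      laurent d (fun x => hline u (cs x) s k (fun t => G x (t1 ++ t)))) ->
  laurent d (fun x => hline u (cs1 ++ cs x) (s1 ++ s) h (G x)).
Proof.
elim: cs1 s1 h G => [|c cs1 IH] [|a s1] h G //= => [_|[sz]] lG.
  exact: (lG [::]).
apply: laurent_hline_fix => b k; apply: IH => // t1 k1 st1.
by apply: (lG (b :: t1)); rewrite /= st1.
Qed.

(** Going up one row adds a vertex to each of the two columns that carry [x], and
    so at most [2] to the degree. *)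
Lemma laurent_triangle us s1 eL eM eR s2 : size s1 = size us ->
  laurent (2 * size us + 2 + ~~ eL + ~~ eR)
    (fun x => triangle (us ++ [:: x]) (s1 ++ [:: eL, eM, eR & s2])).
Proof.
elim: us s1 eL eM eR s2 => [|u us IH] [|a s1] eL eM eR s2 //= => [_|[sz]].
  case: s2 => [|b s2]; first by rewrite muln0; apply: laurent_bottom.
  by apply: eq_laurent (laurent0 K _) => x x0; rewrite /= !big_bool /=; ring.
apply: laurent_sum => h; apply: laurentZ.
apply: (@eq_laurent _ _ _ (fun x => hline u (us ++ [:: x, p, x & rev us])
    (s1 ++ [:: eL, eM, eR & s2]) h (triangle (us ++ [:: x])))).
  by move=> x _; rewrite rev_cat -catA.
apply: (@laurent_hline_cat _ _ (fun x => [:: x, p, x & rev us])) => // t1 k st1.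
(* The two columns that carry x are met one after the other; [fL] and [fR] are
   their edges below the row. *)
have -> : (2 * (size us).+1 + 2 + ~~ eL + ~~ eR =
  (2 * size us + 3 + ~~ eR).+1 + ~~ eL)%N by lia.
apply: (@laurent_hline_var _ (fun x => [:: p, x & rev us])) => fL k1.
apply: (@laurent_hline_fix _ _ (fun x => x :: rev us)) => fM k2.
have -> : (2 * size us + 3 + ~~ eR + ~~ fL =
  (2 * size us + 2 + ~~ fL).+1 + ~~ eR)%N by lia.
apply: (@laurent_hline_var _ (fun x => rev us)) => fR k3.
by apply: laurent_hline_const => t2; apply: IH; rewrite st1.
Qed.

Lemma laurent_triangle_up us : laurent (2 * (size us).+1) (fun x => triangle_up (us ++ [:: x])).
Proof.
have := @laurent_triangle us (nseq (size us) true) true true true (nseq (size us) true).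
rewrite size_nseq => /(_ erefl); rewrite !addn0 -[(_ + 2)%N]/(_ + 2 * 1)%N -mulnDr addn1.
apply: eq_laurent => x _; rewrite /triangle_up /up_top size_cat; congr triangle.
rewrite -[[:: true, true, true & _]]/(nseq 3 true ++ nseq (size us) true).
by rewrite -!nseqD; congr nseq; rewrite /=; lia.
Qed.

Lemma hline0 u cs s h (G : seq bool -> K) : (forall t, G t = 0) -> hline u cs s h G = 0.
Proof.
move=> G0; rewrite (@eq_hline _ _ _ _ _ _ _ _ (fun t => 0 * G t)) ?hline_scale ?mul0r //.
by move=> t; rewrite G0 mulr0.
Qed.

(** At these points one weight of a boundary vertex and one of the middle vertex
    vanish, and what remains cancels. *)
Lemma bottom_zero x eL eM eR : x != 0 ->
    (x = q ^- 2 / p) \/ (x = q ^+ 2 / p) -> bottom x eL eM eR = 0.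
Proof.
move=> x0 xE.
case: xE => ->; rewrite bottomE !big_bool /=.
  case: eL; case: eM; case: eR; rewrite /bulk /rbdry /= ?(mulr0, mul0r, addr0, add0r) //;
  rewrite /sigma; field; rewrite ?p0 ?q0 ?oner_neq0 //.
  case: eL; case: eM; case: eR; rewrite /bulk /rbdry /= ?(mulr0, mul0r, addr0, add0r) //;
  rewrite /sigma; field; rewrite ?p0 ?q0 ?oner_neq0 //.
Qed.

Lemma triangle_zero us x s : x != 0 ->
  (x = q ^- 2 / p) \/ (x = q ^+ 2 / p) -> triangle (us ++ [:: x]) s = 0.
Proof.
move=> x0 xE; elim: us s => [|u us IH] [|a s] //.
  case: s => [|b [|c [|d s]]]; try exact: (bottom_zero a b c x0 xE);
    by rewrite /= !big_bool /= ?big_bool /=; ring.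
by rewrite /= big1 // => h _; rewrite hline0 ?mulr0.
Qed.

End Bound.

(** * The determinant *)

Lemma det_scale_rows (R : comNzRingType) n (r : 'I_n -> R) (A : 'M[R]_n) :
  \det (\matrix_(i, j) (r i * A i j)) = (\prod_i r i) * \det A.
Proof.
have -> : \matrix_(i, j) (r i * A i j) = diag_mx (\row_i r i) *m A.
  by apply/matrixP => i j; rewrite mul_diag_mx !mxE.
by rewrite det_mulmx det_diag; congr (_ * _); apply: eq_bigr => i _; rewrite mxE.
Qed.

(** Subtracting row [j] from row [i0] and taking out a common factor [d]. *)
Lemma det_row_sub (R : comNzRingType) n (A : 'M[R]_n) (i0 j : 'I_n) d (r : 'I_n -> R) :
    i0 != j -> (forall k, A i0 k - A j k = d * r k) ->
  \det A = d * \det (\matrix_(i, k) if i == i0 then r k else A i k).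
Proof.
move=> ij Ar.
pose C := \matrix_(i, k) if i == i0 then A j k else A i k.
rewrite (@determinant_multilinear _ _ A
  (\matrix_(i, k) if i == i0 then r k else A i k) C i0 d 1).
- rewrite mul1r (@determinant_alternate _ _ C i0 j) ?addr0 // => k.
  by rewrite !mxE eqxx eq_sym (negPf ij).
- by apply/rowP => k; rewrite !mxE eqxx -Ar; ring.
- by apply/matrixP => i k; rewrite !mxE eq_sym (negPf (neq_lift _ _)).
- by apply/matrixP => i k; rewrite !mxE eq_sym (negPf (neq_lift _ _)).
Qed.

Lemma prod_neq_ord0 (R : comNzRingType) n (F : 'I_n.+1 -> R) :
  \prod_(l | l != ord0) F l = \prod_(l < n) F (lift ord0 l).
Proof. by rewrite big_mkcond big_ord_recl /= mul1r. Qed.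

Lemma prod_neq_lift0 (R : comNzRingType) n (F : 'I_n.+1 -> R) (k : 'I_n) :
  \prod_(l | l != lift ord0 k) F l =
  F ord0 * \prod_(l < n | l != k) F (lift ord0 l).
Proof.
rewrite big_mkcond big_ord_recl neq_lift; congr (_ * _).
rewrite [RHS]big_mkcond; apply: eq_bigr => l _.
by rewrite (inj_eq lift_inj).
Qed.

Section Det.
Variables (K : fieldType) (q : K).
Hypotheses (q0 : q != 0).

Definition pair_factor (u v : K) : K := sigma (q ^+ 2 * (u * v)) * sigma (q ^+ 2 / (u * v)).

Lemma pair_factorC u v : pair_factor u v = pair_factor v u.
Proof. by rewrite /pair_factor mulrC [v * u]mulrC mulrC. Qed.

(** The matrix of inverses [(pair_factor (u i) (u k))^-1], each row being multiplied
    by the product of its [pair_factor]s. *)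
Definition pair_mx n (u : 'I_n -> K) : 'M[K]_n :=
  \matrix_(i, k) \prod_(l | l != k) pair_factor (u i) (u l).

Definition pair_det (us : seq K) : K := \det (pair_mx (fun i : 'I_(size us) => us`_i)).

Lemma pair_det_inv n (u : 'I_n -> K) : (forall i j, pair_factor (u i) (u j) != 0) ->
  (\prod_i \prod_j pair_factor (u i) (u j)) * \det (\matrix_(i, j) (pair_factor (u i) (u j))^-1) =
  \det (pair_mx u).
Proof.
move=> nz; rewrite -det_scale_rows; congr (\det _).
apply/matrixP => i k; rewrite !mxE (bigD1 k) //=.
by rewrite mulrAC mulfV ?mul1r.
Qed.

Lemma pair_detE n us : size us = n -> pair_det us = \det (pair_mx (fun i : 'I_n => us`_i)).
Proof. by move=> <-. Qed.

Lemma det_pair_mx_perm n (s : 'S_n) (u : 'I_n -> K) :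
  \det (pair_mx (fun i => u (s i))) = \det (pair_mx u).
Proof.
have -> : pair_mx (fun i => u (s i)) = row_perm s (col_perm s (pair_mx u)).
  apply/matrixP => i k; rewrite !mxE [RHS](reindex_inj (@perm_inj _ s)) /=.
  by apply: eq_bigl => l; rewrite (inj_eq perm_inj).
rewrite row_permE col_permE !det_mulmx !det_perm odd_permV mulrCA.
by rewrite -signr_addb addbb mulr1.
Qed.

Lemma pair_det_perm us vs : perm_eq us vs -> pair_det us = pair_det vs.
Proof.
move=> e; have sz := perm_size e.
have /tuple_permP[s Es] : perm_eq us (Tuple (eqxx (size vs))) by [].
rewrite (pair_detE sz) [RHS]/pair_det -(det_pair_mx_perm s (fun i => vs`_i)); congr (\det _).
apply/matrixP => i k; rewrite !mxE.
have E (l : 'I_(size vs)) : us`_l = vs`_(s l) by rewrite Es -tnth_nth tnth_mktuple (tnth_nth 0).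
by apply: eq_bigr => l _; rewrite !E.
Qed.

(** The entries of the row of [u] contain the factor [pair_factor u u], except the
    one on the diagonal. *)
Lemma pair_det_self u us : pair_factor u u = 0 ->
  pair_det (u :: us) = (\prod_(v <- us) pair_factor u v) ^+ 2 * pair_det us.
Proof.
move=> d0; rewrite /pair_det (expand_det_row _ ord0) big_ord_recl /=.
rewrite big1 ?addr0 => [|k _]; last first.
  by rewrite !mxE prod_neq_lift0 /= d0 !mul0r.
rewrite mxE prod_neq_ord0 /cofactor expr0 mul1r expr2 -mulrA.
congr (_ * _); first by rewrite (big_nth 0) big_mkord.
rewrite (big_nth 0) big_mkord -det_scale_rows; congr (\det _).
apply/matrixP => i k; rewrite !mxE prod_neq_lift0 /= pair_factorC.
by congr (_ * _).
Qed.

(** In the row of [u1] only the column of [u2] survives, and conversely; the sign is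
    that of the transposition. *)
Lemma pair_det_pair u1 u2 us : pair_factor u1 u2 = 0 ->
  pair_det (u1 :: u2 :: us) =
  - (pair_factor u1 u1 * pair_factor u2 u2 *
     (\prod_(v <- us) (pair_factor u1 v * pair_factor u2 v)) ^+ 2 * pair_det us).
Proof.
move=> d0; rewrite /pair_det (expand_det_row _ ord0) big_ord_recl /=.
rewrite mxE prod_neq_ord0 big_ord_recl /= d0 !mul0r add0r.
rewrite big_ord_recl /= [X in _ + X]big1 ?addr0 => [|k _]; last first.
  by rewrite mxE prod_neq_lift0 prod_neq_lift0 /= d0 mul0r mulr0 mul0r.
rewrite mxE prod_neq_lift0 prod_neq_ord0 /cofactor /= expr1.
rewrite (expand_det_row _ ord0) big_ord_recl /=.
rewrite [\sum_(i < _) _]big1 ?addr0 => [|k _]; last first.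
  rewrite !mxE.
  have -> : lift (lift ord0 ord0) (lift ord0 k) = lift ord0 (lift ord0 k) :> 'I_(size us).+2.
    by apply: val_inj.
  by rewrite prod_neq_lift0 /= pair_factorC d0 mul0r mul0r.
rewrite /cofactor expr0 mul1r !mxE.
have -> : lift (lift ord0 ord0) ord0 = ord0 :> 'I_(size us).+2 by apply: val_inj.
rewrite prod_neq_ord0 big_ord_recl /=.
set M := (X in \det X).
have -> : \det M = (\prod_(v <- us) (pair_factor u1 v * pair_factor u2 v)) * pair_det us.
  rewrite (big_nth 0) big_mkord -det_scale_rows; congr (\det _).
  apply/matrixP => i k; rewrite !mxE.
  have -> : lift (lift ord0 ord0) (lift ord0 k) = lift ord0 (lift ord0 k) :> 'I_(size us).+2.
    by apply: val_inj.
  by rewrite prod_neq_lift0 prod_neq_lift0 /= mulrA pair_factorC [pair_factor _ u2]pair_factorC.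
have E u : \prod_(l < size us) pair_factor u us`_(0 + l) = \prod_(v <- us) pair_factor u v.
  by rewrite (big_nth 0) big_mkord.
have E2 : \prod_(v <- us) (pair_factor u1 v * pair_factor u2 v) =
  (\prod_(v <- us) pair_factor u1 v) * \prod_(v <- us) pair_factor u2 v by rewrite big_split.
by rewrite !E E2 /pair_det; ring.
Qed.

Lemma laurent_pair_factor u : laurent 2 (fun x => pair_factor x u).
Proof.
rewrite /pair_factor; apply: (@laurentM _ 1 1).
  by apply: eq_laurent (laurent_sigmaM (q ^+ 2 * u)) => x _; congr sigma; ring.
by apply: eq_laurent (laurent_sigmaV (q ^+ 2 / u)) => x _; congr sigma; rewrite invfM; ring.
Qed.

Lemma laurent_pair_factorx : laurent 4 (fun x => pair_factor x x).
Proof. by apply: (@laurentM _ 2 2); [apply: laurent_sigma2 | apply: laurent_sigmaV2]. Qed.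

(** At [x ^+ 2 = u ^+ 2] the first two rows agree and so do the first two columns.
    Subtracting the second row from the first takes out one factor, subtracting the
    columns takes out another; the corner entry, touched by both operations, needs a
    double zero of its own. *)
Lemma pair_det_double (u : K) us : u != 0 ->
  exists2 g, even_laurent g &
    forall x, x != 0 -> pair_det (x :: u :: us) = (x ^+ 2 - u ^+ 2) ^+ 2 * g x.
Proof.
move=> u0; set n := (size us).+2.
pose w x := [:: x, u & us].
pose A x : 'M_n := pair_mx (fun i : 'I_n => (w x)`_i).
pose o0 : 'I_n := ord0; pose o1 : 'I_n := lift ord0 ord0.
have eDD (i k : 'I_n) : even_laurent (fun x => pair_factor (w x)`_i (w x)`_k).
  rewrite /w; case: i k => [[|i] hi] [[|k] hk] /=.
  - by exists 2%N; apply: laurent_pair_factorx.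
  - by exists 1%N; apply: laurent_pair_factor.
  - by exists 1%N; apply: eq_laurent (laurent_pair_factor _) => x _; rewrite pair_factorC.
  - exact: even_laurent_const.
have eA i k : even_laurent (fun x => A x i k).
  have [d l] : even_laurent (fun x => \prod_(l | l != k) pair_factor (w x)`_i (w x)`_l) by exact:
    even_laurent_prod.
  by exists d; apply: eq_laurent l => x _; rewrite mxE.
have /fin_all_exists[r Hr] : forall k, exists g, even_laurent g /\
    forall x, x != 0 -> A x o0 k - A x o1 k = (x ^+ 2 - u ^+ 2) * g x.
  move=> k.
  have [|g eg gE] := even_laurent_root (even_laurentB (eA o0 k) (eA o1 k)) u0.
    by rewrite !mxE subrr.
  by exists g.
have /fin_all_exists[c Hc] : forall i, exists g, even_laurent g /\
    forall x, x != 0 -> A x i o0 - A x i o1 = (x ^+ 2 - u ^+ 2) * g x.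
  move=> i.
  have [|g eg gE] := even_laurent_root (even_laurentB (eA i o0) (eA i o1)) u0.
    rewrite !mxE prod_neq_ord0 prod_neq_lift0 big_ord_recl /=.
    by rewrite prod_neq_ord0 subrr.
  by exists g.
(* The double zero of the corner: after one factor is taken out, the remaining
   bracket [f] still vanishes at [u]. *)
have [z ez zE] : exists2 z, even_laurent z & forall x, x != 0 ->
    A x o0 o0 - A x o1 o0 - (A x o0 o1 - A x o1 o1) = (x ^+ 2 - u ^+ 2) ^+ 2 * z x.
  pose P v := \prod_(l < size us) pair_factor v us`_l.
  have A00 x : A x o0 o0 = pair_factor x u * P x by rewrite mxE prod_neq_ord0 big_ord_recl.
  have A10 x : A x o1 o0 = pair_factor u u * P u by rewrite mxE prod_neq_ord0 big_ord_recl.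
  have A01 x : A x o0 o1 = pair_factor x x * P x by rewrite mxE prod_neq_lift0 prod_neq_ord0.
  have A11 x : A x o1 o1 = pair_factor u x * P u by rewrite mxE prod_neq_lift0 prod_neq_ord0.
  pose f x := P x * (x ^+ 2 - x ^- 4 * u ^- 2) - P u * (u ^+ 2 - x ^- 2 * u ^- 4).
  have exV m : even_laurent (fun x : K => x ^- (2 * m)).
    exists m, 1 => [|x x0]; first by rewrite size_poly1.
    by rewrite mulVf ?expf_neq0 // hornerC.
  have [|||g eg gE] := @even_laurent_root _ f u => //.
  - apply: even_laurentB; apply: even_laurentM; first 1 last.
    + apply: even_laurentB; last by apply: even_laurentM; [exact: (exV 2%N)|exact:
        even_laurent_const].
      exists 1%N, 'X^2; first by rewrite size_polyXn.
      by move=> x _; rewrite hornerXn expr2.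
    + exact: even_laurent_const.
    + apply: even_laurentB; first exact: even_laurent_const.
      by apply: even_laurentM; [exact: (exV 1%N)|exact: even_laurent_const].
    + by apply: even_laurent_prod => l; exists 1%N; apply: laurent_pair_factor.
  - by rewrite /f; field.
  exists g => // x x0; rewrite expr2 -mulrA -gE // A00 A10 A01 A11 /f /pair_factor /sigma.
  by field; rewrite ?x0 ?u0 ?q0.
pose B x := \matrix_(i, k) (if k == o0 then if i == o0 then z x else c i x
                             else if i == o0 then r k x else A x i k).
exists (fun x => \det (B x)).
  apply: even_laurent_det => i k; rewrite /B.
  have [d l] : even_laurent (fun x => if k == o0 then if i == o0 then z x else c i x
                             else if i == o0 then r k x else A x i k).
    case: eqP => _; case: eqP => _ //; [exact: (Hc i).1 | exact: (Hr k).1].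
  by exists d; apply: eq_laurent l => x _; rewrite mxE.
move=> x x0; rewrite /pair_det -/(A x) expr2 -mulrA.
rewrite (@det_row_sub _ _ (A x) o0 o1 (x ^+ 2 - u ^+ 2) (r^~ x)) //; last first.
  by move=> k; apply: (Hr k).2.
(* The second factor is obtained by cancelling the first one, which must
   therefore be nonzero. *)
have [->|xu] := eqVneq (x ^+ 2 - u ^+ 2) 0; first by rewrite !mul0r.
congr (_ * _); rewrite -det_tr -[in RHS]det_tr.
rewrite (@det_row_sub _ _ _ o0 o1 (x ^+ 2 - u ^+ 2)
  (fun i => if i == o0 then z x else c i x)) //.
  congr (_ * \det _); apply/matrixP => i k; by rewrite !mxE.
move=> k; rewrite 2!mxE [X in _ - X]mxE [X in _ - X]mxE.
case: eqP => [_|_]; last by apply: (Hc k).2.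
by apply: (mulfI xu); rewrite mulrBr -(Hr o0).2 // -(Hr o1).2 // zE // mulrA.
Qed.

(** The exponent [e i k] of the entry [(i, k)] plus [2] in the first column depends
    on [i] only, hence all terms of the determinant have the same degree. *)
Lemma laurent_pair_det us : laurent (4 * size us) (fun x => pair_det (x :: us)).
Proof.
set m := size us.
pose e (i k : 'I_m.+1) : nat :=
  if i == ord0 then if k == ord0 then 2 * m else 2 * m + 2
  else if k == ord0 then 0 else 2.
have le i k : laurent (e i k) (fun x => pair_mx (fun i : 'I_m.+1 => (x :: us)`_i) i k).
  rewrite /e; case: (unliftP ord0 i) => [i'|] ->; case: (unliftP ord0 k) => [k'|] ->.
  - rewrite -!(eq_sym ord0) !(negPf (neq_lift _ _)).
    have := laurentM (laurent_pair_factor us`_i') (laurent_const (\prod_(l < m | l !=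
      k') pair_factor us`_i' us`_l)).
    by apply: eq_laurent => x _; rewrite mxE prod_neq_lift0 /= pair_factorC.
  - rewrite -!(eq_sym ord0) !(negPf (neq_lift _ _)) eqxx.
    have := laurent_const (\prod_(l < m) pair_factor us`_i' us`_l).
    by apply: eq_laurent => x _; rewrite mxE prod_neq_ord0.
  - rewrite -!(eq_sym ord0) !(negPf (neq_lift _ _)) eqxx.
    have := laurentM laurent_pair_factorx (laurent_prod (index_enum 'I_m) (fun l => l !=
      k') (fun l => laurent_pair_factor us`_l)).
    have -> : (4 + \sum_(l < m | l != k') 2 = 2 * m + 2)%N.
      by rewrite sum_nat_const cardC1 card_ord; have := ltn_ord k'; lia.
    by apply: eq_laurent => x _; rewrite mxE prod_neq_lift0.
  - rewrite !eqxx.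
    have := laurent_prod (index_enum 'I_m) predT (fun l => laurent_pair_factor us`_l).
    rewrite sum_nat_const card_ord mulnC.
    by apply: eq_laurent => x _; rewrite mxE prod_neq_ord0.
apply: (@eq_laurent _ _ _ (fun x => \sum_(s : 'S_m.+1) (-1) ^+ s *
  \prod_i pair_mx (fun i : 'I_m.+1 => (x :: us)`_i) i (s i))); first by [].
apply: laurent_sum => s; apply: laurentZ.
have -> : (4 * m = \sum_i e i (s i))%N; last by apply: laurent_prod => i; apply: le.
have : (\sum_i (e i (s i) + 2 * (s i == ord0)) = 4 * m + 2)%N.
  under eq_bigr => i _.
    have -> : (e i (s i) + 2 * (s i == ord0) = 2 + 2 * m * (i == ord0))%N.
      by rewrite /e; do 2 case: eqP => _; lia.
    over.
  rewrite big_split /= sum_nat_const card_ord -big_distrr /= (bigD1 ord0) //=.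
  by rewrite big1 => [|i /negPf->] //; lia.
rewrite big_split /= -big_distrr /=.
have -> : (\sum_i (s i == ord0) = 1)%N; last lia.
rewrite (bigD1 ((s^-1)%g ord0)) // permKV eqxx big1 // => i /= /negPf si.
by rewrite -(inj_eq (@perm_inj _ (s^-1)%g)) permK si.
Qed.

End Det.

(** * Vanishing from simple and double roots *)

Lemma prod_XsubC_dvdp (K : fieldType) (s : seq (K * nat)) (P : {poly K}) :
    uniq (unzip1 s) ->
    (forall a, a \in s -> ('X - a.1%:P) ^+ a.2 %| P) ->
  \prod_(a <- s) ('X - a.1%:P) ^+ a.2 %| P.
Proof.
elim: s => [|a s IH] /=; first by rewrite big_nil dvd1p.
case/andP=> as0 us dP; rewrite big_cons Gauss_dvdp.
  by rewrite dP ?mem_head // IH // => b bs; rewrite dP // in_cons bs orbT.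
apply: coprimep_expl; elim: s as0 {IH us dP} => [|b s IH] /=.
  by rewrite big_nil coprimep1.
rewrite in_cons negb_or => /andP[ab as0]; rewrite big_cons coprimepMr IH // andbT.
by apply: coprimep_expr; rewrite coprimep_XsubC root_XsubC eq_sym.
Qed.

Lemma size_prod_XsubC_exp (K : fieldType) (s : seq (K * nat)) :
  size (\prod_(a <- s) ('X - a.1%:P) ^+ a.2) = (\sum_(a <- s) a.2).+1.
Proof.
elim: s => [|a s IH]; first by rewrite !big_nil size_poly1.
rewrite !big_cons size_Mmonic.
- by rewrite size_exp_XsubC IH; lia.
- by rewrite expf_neq0 // polyXsubC_eq0.
- by apply: monic_prod => b _; rewrite monic_exp ?monicXsubC.
Qed.

Section Interpolation.
Variables (K : fieldType) (q : K).
Hypotheses (q0 : q != 0) (qfree : forall k, (0 < k)%N -> q ^+ k != 1).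

(** The powers of [q] give enough squares in any field where [q] is not a root of
    unity. *)
Lemma poly_eq0_sq (P : {poly K}) : (forall x, x != 0 -> P.[x ^+ 2] = 0) -> P = 0.
Proof.
move=> P0; pose rs := [seq (q ^+ k) ^+ 2 | k <- iota 0 (size P)].
apply: (@roots_geq_poly_eq0 _ _ rs).
- by apply/allP => _ /mapP[k _ ->]; rewrite /root P0 ?expf_neq0.
- rewrite map_inj_in_uniq ?iota_uniq // => i j _ _.
  wlog ij : i j / (i <= j)%N => [H E|].
    by case: (leqP i j) => [/H->|/ltnW/H->].
  rewrite -!exprM => E; apply/eqP; rewrite eqn_leq ij leqNgt /=; apply/negP => lt.
  have /negP[] := @qfree ((j - i) * 2)%N ltac:(lia).
  have := E; have -> : (j * 2 = (j - i) * 2 + i * 2)%N by lia.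
  by rewrite exprD -[X in X = _]mul1r => /(mulIf (expf_neq0 _ q0))->.
- by rewrite size_map size_iota.
Qed.

(** The hypothesis on double roots asks for a factorization rather than for a
    vanishing derivative, which would say too little in characteristic [2]. *)
Lemma laurent_eq0 d (f : K -> K) (doubles simples : seq K) :
    ~~ odd d -> laurent d f ->
    all (fun a => a != 0) (doubles ++ simples) ->
    uniq [seq a ^+ 2 | a <- doubles ++ simples] ->
    (d < 2 * size doubles + size simples)%N ->
    (forall a, a \in doubles ->
       exists2 g, even_laurent g & forall x, x != 0 -> f x = (x ^+ 2 - a ^+ 2) ^+ 2 * g x) ->
    (forall a, a \in simples -> f a = 0) ->
  forall x, x != 0 -> f x = 0.
Proof.
move=> od [P sP fP] nz un sz fd fs x x0.
suff P0 : P = 0.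
  by apply: (mulIf (expf_neq0 d x0)); rewrite fP // P0 horner0 mul0r.
pose s := [seq (a ^+ 2, 2%N) | a <- doubles] ++ [seq (a ^+ 2, 1%N) | a <- simples].
apply/eqP; apply: contraT => P0.
have : \prod_(a <- s) ('X - a.1%:P) ^+ a.2 %| P.
  apply: prod_XsubC_dvdp.
    by rewrite /unzip1 map_cat -!map_comp -map_cat.
  move=> b; rewrite mem_cat => /orP[] /mapP[a ain ->] /=.
    have a0 : a != 0 by apply: (allP nz); rewrite mem_cat ain.
    have [g [e [G sG gG]] fg] := fd a ain.
    have PG : P * 'X^e = ('X - (a ^+ 2)%:P) ^+ 2 * G * 'X^(d./2).
      apply/eqP; rewrite -subr_eq0; apply/eqP; apply: poly_eq0_sq => y y0.
      rewrite hornerD hornerN !hornerM !hornerXn hornerXsubC -fP // -gG // fg //.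
      rewrite -!exprM; have -> : (2 * d./2 = d)%N by lia.
      by ring.
    have : ('X - (a ^+ 2)%:P) ^+ 2 %| P * 'X^e by rewrite PG -mulrA dvdp_mulIl.
    rewrite Gauss_dvdpl //; apply: coprimep_expl; apply: coprimep_expr.
    by rewrite coprimep_sym coprimep_XsubC /root hornerX expf_neq0.
  have a0 : a != 0 by apply: (allP nz); rewrite mem_cat ain orbT.
  by rewrite expr1 -root_factor_theorem /root -fP // fs // mul0r.
move=> /(dvdp_leq P0); rewrite size_prod_XsubC_exp big_cat !big_map /=.
rewrite !big_const_seq !count_predT !iter_addn_0.
by move=> /leq_trans/(_ sP); lia.
Qed.

End Interpolation.

(** * Comparison by interpolation *)

Section Main.
Variables (K : fieldType) (p q : K).
Hypotheses (q0 : q != 0) (p0 : p != 0).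

Local Notation triangle := (triangle p q).
Local Notation triangle_up := (triangle_up p q).
Local Notation pair_det := (pair_det q).
Local Notation pair_factor := (pair_factor q).
Local Notation cols := (cols p).

Fixpoint vandermonde (us : seq K) : K :=
  if us is u :: us' then (\prod_(v <- us') sigma (u / v) ^+ 2) * vandermonde us' else 1.

Definition bdry_factor1 u := sigma (q ^+ 2 * p * u) * sigma (q ^+ 2 / (p * u)).
Definition bdry_factor (us : seq K) := \prod_(u <- us) bdry_factor1 u.

(** The theorem with the denominators cleared on both sides. *)
Definition factorized us := triangle_up us * vandermonde us = sigma (q ^+ 4) ^+ size us *
  bdry_factor us * pair_det us.

Lemma sigmaV (x : K) : sigma x^-1 = - sigma x.
Proof. by rewrite /sigma invrK opprB. Qed.

Lemma sigma_sqC (x y : K) : sigma (x / y) ^+ 2 = sigma (y / x) ^+ 2.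
Proof. by rewrite -(invf_div y x) sigmaV sqrrN. Qed.

Lemma sigma1 : sigma (1 : K) = 0.
Proof. by rewrite /sigma invr1 subrr. Qed.

Lemma sigma_eq0 (x : K) : x != 0 -> (sigma x == 0) = (x ^+ 2 == 1).
Proof.
move=> x0; rewrite /sigma subr_eq0 -(inj_eq (mulIf x0)) mulVf //.
Qed.

Lemma vandermonde_move us (x : K) us1 :
  vandermonde (us ++ x :: us1) = vandermonde (x :: us ++ us1).
Proof.
elim: us => [|u us IH] //=.
rewrite IH /= !big_cons !big_cat /= !big_cons (sigma_sqC u x).
by ring.
Qed.

Lemma prod_cols us (f : K -> K) :
  \prod_(c <- cols us) f c = f p * (\prod_(c <- us) f c) ^+ 2.
Proof.
rewrite /cols big_cat big_cons /=.
have -> : \prod_(c <- rev us) f c = \prod_(c <- us) f c.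
  by apply: perm_big; rewrite perm_rev.
by ring.
Qed.

Lemma factorized_self (x : K) vs : x != 0 -> x ^+ 2 = q ^- 2 ->
  factorized vs -> factorized (x :: vs).
Proof.
move=> x0 x2 IH; rewrite /factorized in IH *.
have xq : x^-1 = q ^+ 2 * x.
  by apply: (mulIf x0); rewrite mulVf // -mulrA -expr2 x2 divff // expf_neq0.
have s0 : sigma (q ^+ 2 * x ^+ 2) = 0 by rewrite x2 divff ?expf_neq0 ?sigma1.
rewrite triangle_up_self // pair_det_self; last by rewrite /pair_factor -expr2 s0 mul0r.
rewrite prod_cols /= /bdry_factor big_cons /bdry_factor1 -/(bdry_factor vs).
have -> : sigma (p / x) = sigma (q ^+ 2 * p * x) by rewrite xq; congr sigma; ring.
have -> : sigma (q ^+ 2 / x ^+ 2) = sigma (q ^+ 4) by rewrite x2 invrK -exprD.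
have -> : (\prod_(v <- vs) pair_factor x v) ^+ 2 =
   (\prod_(c <- vs) sigma (q ^+ 2 / (x * c))) ^+ 2 * \prod_(v <- vs) sigma (x / v) ^+ 2.
  rewrite -!prodrXl -big_split; apply: eq_bigr => v _ /=.
  rewrite (sigma_sqC x) xq /pair_factor exprMn mulrC; congr (_ * sigma _ ^+ 2); ring.
by rewrite [x * p]mulrC (exprS (sigma _)); ring: IH.
Qed.

Lemma factorized_pair_left (x v : K) ws : x != 0 -> v != 0 -> x * v = q ^- 2 ->
  factorized ws -> factorized (x :: v :: ws).
Proof.
move=> x0 v0 xv IH; rewrite /factorized in IH *.
have xq : q ^+ 2 * x = v^-1.
  by apply: (mulIf v0); rewrite mulVf // -mulrA xv divff // expf_neq0.
have vq : q ^+ 2 * v = x^-1.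
  by apply: (mulIf x0); rewrite mulVf // -mulrA [v * x]mulrC xv divff // expf_neq0.
rewrite triangle_up_pair_left // pair_det_pair;
  last by rewrite /pair_factor xv divff ?expf_neq0 ?sigma1 ?mul0r.
rewrite prod_cols /= /bdry_factor !big_cons /bdry_factor1 -/(bdry_factor ws).
have -> : sigma (q ^+ 2 * p * x) = sigma (p / v) by rewrite -xq; congr sigma; ring.
have -> : sigma (q ^+ 2 * p * v) = sigma (p / x) by rewrite -vq; congr sigma; ring.
have -> : pair_factor x x = sigma (x / v) * sigma (q ^+ 2 / x ^+ 2).
  by rewrite /pair_factor mulrA xq [_^-1 * x]mulrC -expr2.
have -> : pair_factor v v = - sigma (x / v) * sigma (q ^+ 2 / v ^+ 2).
  by rewrite /pair_factor mulrA vq -expr2 -sigmaV invf_div [v / x]mulrC.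
have -> : (\prod_(w <- ws) (pair_factor x w * pair_factor v w)) ^+ 2 =
   (\prod_(w <- ws) (sigma (q ^+ 2 / (x * w)) * sigma (q ^+ 2 / (v * w)))) ^+ 2 *
   (\prod_(w <- ws) sigma (x / w) ^+ 2) * (\prod_(w <- ws) sigma (v / w) ^+ 2).
  rewrite -!prodrXl -!big_split; apply: eq_bigr => w _ /=.
  by rewrite (sigma_sqC x) (sigma_sqC v) /pair_factor !mulrA xq vq ![_^-1 * w]mulrC; ring.
by rewrite [x * p]mulrC [v * p]mulrC !(exprS (sigma _)); ring: IH.
Qed.

Lemma factorized_pair_right (x v : K) ws : x != 0 -> v != 0 -> x * v = q ^+ 2 ->
  factorized ws -> factorized (x :: v :: ws).
Proof.
move=> x0 v0 xv IH; rewrite /factorized in IH *.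
have xq : q ^+ 2 / x = v by rewrite -xv mulrAC divff // mul1r.
have vq : q ^+ 2 / v = x by rewrite -xv mulfK.
rewrite triangle_up_pair_right // pair_det_pair;
  last by rewrite /pair_factor xv divff ?expf_neq0 ?sigma1 ?mulr0.
rewrite prod_cols /= /bdry_factor !big_cons /bdry_factor1 -/(bdry_factor ws).
have -> : sigma (q ^+ 2 / (p * x)) = sigma (v / p) by rewrite -xq invfM; congr sigma; ring.
have -> : sigma (q ^+ 2 / (p * v)) = sigma (x / p) by rewrite -vq invfM; congr sigma; ring.
have -> : pair_factor x x = - sigma (x / v) * sigma (q ^+ 2 * x ^+ 2).
  by rewrite /pair_factor invfM [q ^+ 2 * (x^-1 * _)]mulrA xq -sigmaV invf_div -expr2 mulrC.
have -> : pair_factor v v = sigma (x / v) * sigma (q ^+ 2 * v ^+ 2).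
  by rewrite /pair_factor invfM [q ^+ 2 * (v^-1 * _)]mulrA vq -expr2 mulrC.
have -> : (\prod_(w <- ws) (pair_factor x w * pair_factor v w)) ^+ 2 =
   (\prod_(w <- ws) (sigma (q ^+ 2 * (x * w)) * sigma (q ^+ 2 * (v * w)))) ^+ 2 *
   (\prod_(w <- ws) sigma (x / w) ^+ 2) * (\prod_(w <- ws) sigma (v / w) ^+ 2).
  rewrite -!prodrXl -!big_split; apply: eq_bigr => w _ /=.
  by rewrite /pair_factor !invfM !mulrA xq vq; ring.
have -> : q ^+ 2 * (x * p) = q ^+ 2 * p * x by ring.
have -> : q ^+ 2 * (v * p) = q ^+ 2 * p * v by ring.
by rewrite !(exprS (sigma _)); ring: IH.
Qed.

Lemma factorized_move x vs v ws : x != 0 -> all (fun c => c != 0) (vs ++ v :: ws) ->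
  all (fun u => sigma (q ^+ 4 * (v / u)) != 0) vs ->
  factorized (x :: v :: vs ++ ws) -> factorized (x :: vs ++ v :: ws).
Proof.
move=> x0 nz sv; rewrite /factorized => H.
have e : perm_eq (vs ++ v :: ws) (v :: vs ++ ws) by rewrite -cat1s perm_catCA.
rewrite -[x :: vs ++ _]/([:: x] ++ vs ++ v :: ws) triangle_up_move //=; first last.
- by apply/allP => u us; rewrite (allP sv).
- by rewrite x0.
rewrite (perm_big _ e) vandermonde_move /bdry_factor.
have e' : perm_eq (x :: vs ++ v :: ws) (x :: v :: vs ++ ws) by rewrite perm_cons.
by rewrite (perm_big _ e') (pair_det_perm _ e') (perm_size e).
Qed.

(** The monomials that must differ for the roots of the interpolation to be distinct
    and for the scalars in [triangle_up_swap] not to vanish.  It is applied to the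
    list of all [u i] preceded by [p], since the roots attached to [p] have the same
    form as those attached to the [u i]. *)
Definition generic (ws : seq K) :=
  [/\ all (fun w => w != 0) ws,
      uniq [seq w ^+ 2 | w <- ws],
      forall w, w \in ws -> (w ^+ 2 * q ^+ 2 != 1) && (w ^+ 2 != q ^+ 6)
    & forall v w, v \in ws -> w \in ws ->
      [&& v ^+ 2 * w ^+ 2 != q ^+ 4, v ^+ 2 * w ^+ 2 * q ^+ 4 != 1
        & q ^+ 8 * v ^+ 2 != w ^+ 2]].

Lemma generic_subseq ws ws' : subseq ws ws' -> generic ws' -> generic ws.
Proof.
move=> sb [nz un g1 g2]; have sub := mem_subseq sb; split.
- by apply/allP => w /sub; apply: (allP nz).
- exact: subseq_uniq (map_subseq _ sb) un.
- by move=> w /sub; apply: g1.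
- by move=> v w /sub vi /sub; apply: g2.
Qed.

Hypothesis qfree : forall k, (0 < k)%N -> q ^+ k != 1.

Lemma uniq_roots vs : generic (p :: vs) ->
  uniq [seq a ^+ 2 | a <- vs ++ (q^-1 :: [seq q ^- 2 / w | w <- p :: vs]
                                    ++ [seq q ^+ 2 / w | w <- p :: vs])].
Proof.
move=> [nz un g1 g2]; set ls := [seq q ^- 2 / w | w <- _].
set rs := [seq q ^+ 2 / w | w <- _].
have q2 k : q ^+ k != 0 by rewrite expf_neq0.
have w0 w : w \in p :: vs -> w ^+ 2 != 0 by move=> /(allP nz)?; rewrite expf_neq0.
have vin v : v \in vs -> v \in p :: vs by move=> vi; rewrite in_cons vi orbT.
have L w : (q ^- 2 / w) ^+ 2 = q ^- 4 / w ^+ 2 by rewrite exprMn !exprVn -exprM.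
have R w : (q ^+ 2 / w) ^+ 2 = q ^+ 4 / w ^+ 2 by rewrite exprMn exprVn -exprM.
have U c : c != 0 -> uniq [seq c / w ^+ 2 | w <- p :: vs].
  move=> c0; rewrite (map_comp (fun y => c / y) (fun w => w ^+ 2)) map_inj_uniq //.
  by move=> a b /(mulfI c0)/invr_inj.
rewrite map_cat cat_uniq; apply/and3P; split.
- by case/andP: un.
- apply/hasPn => y; rewrite map_cons in_cons map_cat mem_cat => /or3P[/eqP->||].
  + apply/mapP => -[v vi E]; have /andP[/negP[]] := g1 v (vin v vi).
    by rewrite -E exprVn mulVf.
  + move=> /mapP[_ /mapP[w wi ->] ->]; apply/mapP => -[v vi E].
    have /and3P[_ /negP ne _] := g2 v w (vin v vi) wi; apply: ne; apply/eqP.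
    by rewrite -E; field; rewrite q0 (allP nz).
  + move=> /mapP[_ /mapP[w wi ->] ->]; apply/mapP => -[v vi E].
    have /and3P[/negP ne _ _] := g2 v w (vin v vi) wi; apply: ne; apply/eqP.
    by rewrite -E; field; rewrite (allP nz).
rewrite map_cons cons_uniq map_cat mem_cat negb_or cat_uniq; apply/andP; split; [apply/andP;
  split|apply/and3P; split].
- apply/mapP => -[_ /mapP[w wi ->]]; rewrite L => E.
  have /andP[/negP[]] := g1 w wi; apply/eqP.
  have -> : w ^+ 2 * q ^+ 2 = q^-1 ^+ 2 * (q ^+ 4 * w ^+ 2) by field.
  by rewrite E; field; rewrite ?q0 (allP nz).
- apply/mapP => -[_ /mapP[w wi ->]]; rewrite R => E.
  have /andP[_ /negP[]] := g1 w wi; apply/eqP.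
  have -> : w ^+ 2 = q^-1 ^+ 2 * (q ^+ 2 * w ^+ 2) by field.
  by rewrite E; field; rewrite (allP nz).
- by rewrite -map_comp (eq_map L) U ?invr_eq0.
- apply/hasPn => _ /mapP[_ /mapP[w wi ->] ->]; apply/mapP => -[_ /mapP[v vi ->]].
  rewrite L R => E; have /and3P[_ _ /negP[]] := g2 v w vi wi; apply/eqP.
  have -> : q ^+ 8 * v ^+ 2 = q ^+ 4 / w ^+ 2 * (q ^+ 4 * v ^+ 2 * w ^+ 2).
    by field; rewrite (allP nz).
  by rewrite E; field; rewrite ?q0 (allP nz).
- by rewrite -map_comp (eq_map R) U.
Qed.

Lemma even_laurent_sigma_sq (w : K) : even_laurent (fun x => sigma (x / w) ^+ 2).
Proof.
exists 1%N; have := laurentM (laurent_sigmaM w^-1) (laurent_sigmaM w^-1).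
by apply: eq_laurent => x _; rewrite expr2 (mulrC x).
Qed.

(** The parameter [x0] is replaced by a variable [x], and the difference [f] of the
    two sides vanishes by [laurent_eq0]. *)
Theorem factorized_generic us : generic (p :: us) -> factorized us.
Proof.
move: {2}(size us) (leqnn (size us)) => N; elim: N us => [|N IH] [|x0 vs] //.
- move=> _ _; rewrite /factorized /bdry_factor big_nil /triangle_up /pair_det /pair_mx /= det_mx00.
  by rewrite expr0 !mul1r.
- move=> _ _; rewrite /factorized /bdry_factor big_nil /triangle_up /pair_det /pair_mx /= det_mx00.
  by rewrite expr0 !mul1r.
rewrite ltnS => szN gx0; set m := size vs.
have gvs : generic (p :: vs).
  apply: generic_subseq gx0; rewrite [subseq _ _]/= eqxx; exact: subseq_cons.
have [nz _ g1 g2] := gx0.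
have vin v : v \in vs -> v \in p :: x0 :: vs by move=> vi; rewrite !in_cons vi !orbT.
have nzv v : v \in vs -> v != 0 by move=> /vin/(allP nz).
have nzvs : all (fun c => c != 0) vs by apply/allP.
(* [x] stands in the bottom row, where the degree is small. *)
pose f x := triangle_up (vs ++ [:: x]) * ((\prod_(v <- vs) sigma (x / v) ^+ 2) * vandermonde vs) -
  sigma (q ^+ 4) ^+ m.+1 * (bdry_factor1 x * bdry_factor vs) * pair_det (x :: vs).
have lb : laurent 2 bdry_factor1.
  have := laurentM (laurent_sigmaM (q ^+ 2 * p)) (laurent_sigmaV (q ^+ 2 / p)).
  by apply: eq_laurent => x _; rewrite /bdry_factor1 invfM mulrA.
have lf : laurent (4 * m + 2) f.
  have l1 := laurent_triangle_up p0 q0 vs.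
  have l2 := laurent_prod vs predT (fun v => laurentM (laurent_sigmaM v^-1) (laurent_sigmaM v^-1)).
  have l3 := laurentM l1 (laurentM l2 (laurent_const (vandermonde vs))).
  have l4 := laurentM (laurentM (laurent_const (sigma (q ^+ 4) ^+
    m.+1)) (laurentM lb (laurent_const (bdry_factor vs))))
     (laurent_pair_det q0 vs).
  move: l3 l4; rewrite big_const_seq count_predT iter_addn_0 -/m.
  have -> : (2 * m.+1 + (2 * m + 0) = 4 * m + 2)%N by lia.
  have -> : (0 + (2 + 0) + 4 * m = 4 * m + 2)%N by lia.
  move=> l3 /(laurentZ (-1)) l4; apply: eq_laurent (laurentD l3 l4) => x _.
  rewrite /f mulN1r; congr (_ * (_ * _) - _).
  by apply: eq_bigr => v _; rewrite expr2 (mulrC x).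
(* The values are computed with [x] in the top row. *)
have mv x : x != 0 -> (forall u, u \in vs -> (sigma (q ^+ 4 * (x / u)) != 0) ||
    (sigma (q ^+ 4 * (u / x)) != 0)) -> triangle_up (vs ++ [:: x]) = triangle_up (x :: vs).
  move=> xn0 H; have := @triangle_up_move _ p q p0 q0 [::] vs x [::].
  rewrite /= cats0; apply; last by apply/allP.
  by rewrite all_cat nzvs /= xn0.
have fE x : x != 0 -> (forall u, u \in vs -> (sigma (q ^+ 4 * (x / u)) != 0) ||
    (sigma (q ^+ 4 * (u / x)) != 0)) -> f x = 0 <-> factorized (x :: vs).
  move=> xn0 H; rewrite /f mv // /factorized /= /bdry_factor big_cons -/(bdry_factor vs).
  by split=> [/eqP|->]; rewrite ?subrr // subr_eq0 => /eqP.
have x0n : x0 != 0 by apply: (allP nz); rewrite !in_cons eqxx orbT.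
suff f0 : f x0 = 0.
  apply/fE => // u ui; apply/orP; left; rewrite sigma_eq0; last first.
    by rewrite !mulf_neq0 ?expf_neq0 ?invr_eq0 ?(nzv _ ui).
  have x0i : x0 \in p :: x0 :: vs by rewrite !in_cons eqxx orbT.
  have /and3P[_ _] := g2 x0 u x0i (vin u ui).
  apply: contraNneq => E; apply/eqP; rewrite -[RHS]mul1r -E; field; exact: nzv.
have u0 u : u \in p :: vs -> u != 0.
  by rewrite in_cons => /orP[/eqP->|] //; apply: nzv.
apply: (laurent_eq0 q0 qfree _ lf _ (uniq_roots gvs)) => //; first by rewrite oddD oddM.
- apply/allP => a; rewrite mem_cat in_cons mem_cat => /or4P[/nzv|/eqP->| |] //.
  + by rewrite invr_eq0.
  + by case/mapP=> w wi ->; rewrite mulf_neq0 ?invr_eq0 ?expf_neq0 ?(u0 _ wi).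
  + by case/mapP=> w wi ->; rewrite mulf_neq0 ?invr_eq0 ?expf_neq0 ?(u0 _ wi).
- by rewrite /= size_cat /= !size_map -/m; lia.
- move=> v vi; have e := perm_to_rem vi.
  have [g eg gE] := pair_det_double q0 (rem v vs) (nzv _ vi).
  have e1 : even_laurent (fun x : K => triangle_up (vs ++ [:: x]) * (x ^- 2 * (v ^- 2 *
      ((\prod_(w <- rem v vs) sigma (x / w) ^+ 2) * vandermonde vs)))).
    apply: even_laurentM; first by exists m.+1; apply: (laurent_triangle_up p0 q0).
    apply: even_laurentM.
      exists 1%N, 1 => [|x xn0]; first by rewrite size_poly1.
      by rewrite mulVf ?expf_neq0 // hornerC.
    apply: even_laurentM; first exact: even_laurent_const.
    by apply: even_laurentM; [apply: even_laurent_prod => w; apply: even_laurent_sigma_sq |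
      apply: even_laurent_const].
  have e2 := even_laurentM (even_laurentM (even_laurent_const (sigma (q ^+ 4) ^+ m.+1))
    (even_laurentM (ex_intro _ 1%N lb) (even_laurent_const (bdry_factor vs)))) eg.
apply: (ex_intro2 _ _ _ (even_laurentB e1 e2)).
  move=> x xn0 /=; rewrite /f (perm_big _ e) big_cons.
  have -> : pair_det (x :: vs) = pair_det (x :: v :: rem v vs).
    by apply: pair_det_perm; rewrite perm_cons.
  rewrite gE //.
  have -> : sigma (x / v) ^+ 2 = (x ^+ 2 - v ^+ 2) ^+ 2 * (x ^- 2 * v ^- 2).
    by rewrite /sigma; field; rewrite xn0 nzv.
  by rewrite /=; ring.
have S x u : x != 0 -> u != 0 -> (q ^+ 4 * (x / u)) ^+ 2 != 1 -> sigma (q ^+ 4 * (x / u)) != 0.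
  by move=> ? ? ?; rewrite sigma_eq0 // !mulf_neq0 ?expf_neq0 ?invr_eq0.
have pair x w : x != 0 -> w \in vs -> (x * w = q ^- 2) \/ (x * w = q ^+ 2) ->
    factorized (x :: vs).
  move=> xn0 wi; have := nzvs; have szvs : (size vs <= N)%N by [].
  move: szvs; have := gvs.
  have : {in vs, forall u, sigma (q ^+ 4 * (w / u)) != 0}.
    move=> u ui; apply: S; [exact: nzv | exact: nzv |].
    have /and3P[_ _] := g2 w u (vin w wi) (vin u ui).
    apply: contraNneq => E; apply/eqP; rewrite -[RHS]mul1r -E; field; exact: nzv.
  have w0 := nzv w wi.
  case/splitPr: wi => ws1 ws2 sw gws; rewrite size_cat /= => sz nzw xw.
  apply: factorized_move => //.
    by apply/allP => u ui; apply: sw; rewrite mem_cat ui.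
  have Cws : factorized (ws1 ++ ws2).
    apply: IH; first by rewrite size_cat; lia.
    apply: generic_subseq gws; rewrite [subseq _ _]/= eqxx.
    by apply: cat_subseq => //; apply: subseq_cons.
  by case: xw => xw; [apply: factorized_pair_left | apply: factorized_pair_right].
have fp a : a != 0 -> (a = q ^- 2 / p) \/ (a = q ^+ 2 / p) -> f a = 0.
  move=> a0 aE; rewrite /f /triangle_up triangle_zero // mul0r sub0r.
  suff -> : bdry_factor1 a = 0 by rewrite mul0r mulr0 mul0r oppr0.
  rewrite /bdry_factor1; case: aE => ->.
    by rewrite [X in sigma X * _](_ : _ = 1) ?sigma1 ?mul0r //; field; rewrite p0 q0.
  by rewrite [X in _ * sigma X](_ : _ = 1) ?sigma1 ?mulr0 //; field; rewrite p0 q0.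
move=> a; rewrite in_cons mem_cat => /or3P[/eqP->| |].
- have qi0 : q^-1 != 0 by rewrite invr_eq0.
  apply/fE => //; last first.
    by apply: factorized_self; rewrite ?exprVn //; apply: IH.
  move=> u ui; apply/orP; left; apply: S => //; first exact: nzv.
  have /andP[_] := g1 u (vin u ui).
  by apply: contraNneq => E; apply/eqP; rewrite -[LHS]mul1r -E; field; rewrite q0 nzv.
- case/mapP=> w; rewrite in_cons => /orP[/eqP->|wi] ->.
    by apply: fp; [rewrite mulf_neq0 ?invr_eq0 ?expf_neq0 | left].
  have a0 : q ^- 2 / w != 0 by rewrite mulf_neq0 ?invr_eq0 ?expf_neq0 ?(nzv _ wi).
  apply/fE => //; last by apply: (pair _ w) => //; left; rewrite mulfVK ?nzv.
  move=> u ui; apply/orP; left; apply: S => //; first exact: nzv.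
  have /and3P[+ _ _] := g2 w u (vin w wi) (vin u ui).
  by apply: contraNneq => E; apply/eqP; rewrite -[LHS]mul1r -E; field; rewrite q0 !nzv.
- case/mapP=> w; rewrite in_cons => /orP[/eqP->|wi] ->.
    by apply: fp; [rewrite mulf_neq0 ?invr_eq0 ?expf_neq0 | right].
  have a0 : q ^+ 2 / w != 0 by rewrite mulf_neq0 ?invr_eq0 ?expf_neq0 ?(nzv _ wi).
  apply/fE => //; last by apply: (pair _ w) => //; right; rewrite mulfVK ?nzv.
  move=> u ui; apply/orP; right; apply: S => //; first exact: nzv.
  have /and3P[_ + _] := g2 w u (vin w wi) (vin u ui).
  by apply: contraNneq => E; apply/eqP; rewrite -E; field; rewrite q0 nzv.
Qed.

End Main.

(** * Sums over sets of edges *)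

Section SetSum.
Variables (K : fieldType) (E : finType).
Implicit Types (A B : {set E}) (L : seq E) (F : {set E} -> K).

(** Sum of [F] over all ways of putting the edges of [L] into or out of [A], one
    edge at a time; this is the shape of the nested sums in [hline]. *)
Fixpoint edge_sum L F A : K :=
  if L is e :: L' then edge_sum L' F (e |: A) + edge_sum L' F (A :\ e) else F A.

Lemma edge_sum_cons e L F A :
  edge_sum (e :: L) F A = edge_sum L F (e |: A) + edge_sum L F (A :\ e).
Proof. by []. Qed.

Lemma edge_sum_cat L1 L2 F A : edge_sum (L1 ++ L2) F A = edge_sum L1 (edge_sum L2 F) A.
Proof. by elim: L1 A => [|e L1 IH] A //=; rewrite !IH. Qed.

Lemma eq_edge_sum L F F' A :
    (forall B, (forall e, e \notin L -> (e \in B) = (e \in A)) -> F B = F' B) ->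
  edge_sum L F A = edge_sum L F' A.
Proof.
elim: L A => [|e L IH] A eF /=; first by apply: eF.
by congr (_ + _); apply: IH => B AB; apply: eF => e';
  rewrite in_cons negb_or => /andP[/negPf ee' eL]; rewrite AB // !inE ee'.
Qed.

Lemma edge_sum_scale L F c A : edge_sum L (fun B => c * F B) A = c * edge_sum L F A.
Proof. by elim: L A => [|e L IH] A //=; rewrite !IH mulrDr. Qed.

Lemma edge_sum_subset L F A : uniq L -> [disjoint A & L] ->
  edge_sum L F A = \sum_(B : {set E} | B \subset L) F (A :|: B).
Proof.
elim: L A => [|e L IH] A /=.
  move=> _ _; rewrite (big_pred1 set0) ?setU0 // => B /=.
  apply/subsetP/eqP => [sB|-> x]; last by rewrite inE.
  by apply/setP => x; rewrite inE; apply/negP => /sB.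
case/andP=> eL uL; rewrite disjoint_sym disjoint_cons => /andP[eA dA].
have AD : A :\ e = A.
  by apply/setP => x; rewrite !inE; case: eqP => // ->; rewrite (negPf eA).
have subL (B : {set E}) : (B \subset L) = (B \subset e :: L) && (e \notin B).
  apply/idP/andP => [BL|[BL eB]].
    split; first by apply: subset_trans BL _; apply/subsetP => x; rewrite in_cons orbC => ->.
    by apply: contra eL => /(subsetP BL).
  apply/subsetP => x xB; have := subsetP BL x xB; rewrite in_cons => /orP[/eqP xe|//].
  by rewrite -xe xB in eB.
rewrite AD !IH //; last 2 first.
- by rewrite disjoint_sym.
- apply/pred0P => x /=; rewrite !inE; case: eqP => [->|_] /=; first exact/negbTE.
  by have /pred0P/(_ x) := dA; rewrite /= andbC.
rewrite [RHS](bigID (fun B : {set E} => e \in B)) /=; congr (_ + _); last first.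
  by apply: eq_bigl => B; rewrite subL.
rewrite [RHS](reindex_onto (fun B => e |: B) (fun B => B :\ e)) /=; last first.
  by move=> B /andP[_ eB]; rewrite setD1K.
apply: eq_big => [B|B _]; last by rewrite setUCA setUA.
apply/idP/andP => [|[/andP[BL _] /eqP EB]].
  rewrite subL => /andP[BL eB]; rewrite setU11 setU1K // eqxx; split=> //.
  rewrite andbT; apply/subsetP => x; rewrite inE => /orP[/set1P->|/(subsetP BL)//].
  exact: mem_head.
rewrite subL (subset_trans _ BL) ?subsetUr //=.
by rewrite -EB !inE eqxx.
Qed.
End SetSum.

(** * Rows of the triangle *)

Section Rows.
Variables (K : fieldType) (p q : K) (n : nat) (c : nat -> K).
Hypothesis cp : c n.+1 = p.

(** An edge is named by a vertex and a boolean: [(true, x)] is the vertical edge below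
    [x] and [(false, x)] the horizontal edge to the right of [x].  A set of such
    edges stands for the orientation in which they point up, resp. right, while all
    others point down, resp. left. *)
Definition vtx (r j : nat) : grid n := (inord r, inord j).
Definition vedge r j : bool * grid n := (true, vtx r j).
Definition hedge r j : bool * grid n := (false, vtx r j).
Implicit Types A : {set bool * grid n}.

Definition bulk_at A r j : K :=
  bulk q (vedge r.-1 j \in A) (vedge r j \in A) (hedge r j.-1 \in A) (hedge r j \in A)
    (c r * c (minn j (2 * n + 2 - j))).
Definition left_at A r : K :=
  lbdry p q (vedge r.-1 r \in A) (hedge r r \in A) (c r).
Definition right_at A r j : K :=
  rbdry p q (vedge r.-1 j \in A) (hedge r j.-1 \in A) (c r).

Definition bulk_edges r js := flatten [seq [:: vedge r j; hedge r j] | j <- js].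
Definition row_edges r m := hedge r r :: bulk_edges r (iota r.+1 (2 * m).-1).
Definition row_weight A r m :=
  left_at A r * (\prod_(j <- iota r.+1 (2 * m).-1) bulk_at A r j) * right_at A r (r + 2 * m).

(** The [m] rows from [r] on, each with the vertical edges below it, in the order in
    which [triangle] sums over them. *)
Fixpoint edges_from r m := if m is m'.+1 then row_edges r m ++ edges_from r.+1 m' else [::].
Fixpoint weight_from A r m := if m is m'.+1 then row_weight A r m * weight_from A r.+1 m' else 1.

Definition vstates A r js := [seq vedge r j \in A | j <- js].

Lemma vtx_inj r j r' j' : (r < n.+2)%N -> (j < (2 * n).+2)%N ->
  (r' < n.+2)%N -> (j' < (2 * n).+2)%N -> (vtx r j == vtx r' j') = (r == r') && (j == j').
Proof.
move=> hr hj hr' hj'; rewrite /vtx xpair_eqE -!val_eqE /=.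
by rewrite !inordK.
Qed.

Lemma mem_bulk_edges r js e : e \in bulk_edges r js ->
  exists2 j, j \in js & e = vedge r j \/ e = hedge r j.
Proof.
move=> /flattenP[_ /mapP[j ji ->]]; rewrite !inE => he; exists j => //.
by case/orP: he => /eqP ->; [left|right].
Qed.

Lemma edges_from_row r m e : (r + m <= n.+1)%N -> e \in edges_from r m -> (r <= e.2.1)%N.
Proof.
elim: m r => [|m IH] r //= rm; rewrite in_cons mem_cat => /or3P[/eqP->||/IH H].
- by rewrite /= inordK //; lia.
- by move=> /mem_bulk_edges[j _ [] ->]; rewrite /= inordK //; lia.
- by apply: leq_trans (H _); lia.
Qed.

(** One row, from column [j0] on: the vertices to the right of the edge
    [hedge r j0]. *)
Lemma edge_sum_row r A j0 len (G : seq bool -> K) :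
    (0 < r <= n)%N -> (r <= j0)%N -> (j0 + len + 1 <= 2 * n + 1)%N ->
  edge_sum (bulk_edges r (iota j0.+1 len)) (fun B =>
      (\prod_(j <- iota j0.+1 len) bulk_at B r j) * right_at B r (j0 + len).+1 *
      G (vstates B r (iota j0.+1 len))) A =
  hline p q (c r) [seq c (minn j (2 * n + 2 - j)) | j <- iota j0.+1 len]
    (vstates A r.-1 (iota j0.+1 len.+1)) (hedge r j0 \in A) G.
Proof.
move=> /andP[r0 rn]; elim: len j0 A G => [|len IH] j0 A G rj jn.
  by rewrite /= big_nil mul1r addn0.
set js := iota j0.+2 len.
have nev j j' : vedge r.-1 j != vedge r j'.
  rewrite /vedge /vtx !xpair_eqE eqxx /= -val_eqE /= !inordK; lia.
have nej j j' : (j < j')%N -> (j' < (2 * n).+2)%N -> vtx r j != vtx r j'.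
  by move=> jj hj; rewrite vtx_inj ?eqxx /=; lia.
have vin B e : (forall e', e' \notin bulk_edges r js -> (e' \in B) = (e' \in e)) ->
   [/\ (vedge r j0.+1 \in B) = (vedge r j0.+1 \in e),
       (hedge r j0.+1 \in B) = (hedge r j0.+1 \in e),
       (hedge r j0 \in B) = (hedge r j0 \in e) &
       forall j, (vedge r.-1 j \in B) = (vedge r.-1 j \in e)].
  move=> H; split=> [||| j]; apply: H; apply/negP => /mem_bulk_edges[j'];
    rewrite mem_iota => j'i [] // /eqP; rewrite ?(negPf (nev _ _)) //.
  - by rewrite /vedge xpair_eqE eqxx /= (negPf (nej _ _ _ _)) //; lia.
  - by rewrite /hedge xpair_eqE eqxx /= (negPf (nej _ _ _ _)) //; lia.
  - by rewrite /hedge xpair_eqE eqxx /= (negPf (nej _ _ _ _)) //; lia.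
have step B : edge_sum (bulk_edges r js) (fun B =>
      (\prod_(j <- iota j0.+1 len.+1) bulk_at B r j) * right_at B r (j0 + len.+1).+1 *
      G (vstates B r (iota j0.+1 len.+1))) B =
  bulk_at B r j0.+1 * hline p q (c r) [seq c (minn j (2 * n + 2 - j)) | j <- js]
    (vstates B r.-1 (iota j0.+2 len.+1)) (hedge r j0.+1 \in B)
    (fun t => G ((vedge r j0.+1 \in B) :: t)).
  rewrite -IH; try lia. rewrite -edge_sum_scale; apply: eq_edge_sum => B' /vin[e1 e2 e3 e4].
  rewrite /= big_cons -addSnnS e1 !mulrA; congr (_ * _ * _ * _).
  by rewrite /bulk_at e1 e2 e3 e4.
have nvh j j' : vedge r j == hedge r j' = false by [].
have nvh' j j' : vedge r.-1 j == hedge r j' = false by [].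
have nhv j j' : hedge r j == vedge r j' = false by [].
have nhh : hedge r j0 == hedge r j0.+1 = false.
  by rewrite /hedge xpair_eqE eqxx /= (negPf (nej _ _ _ _)) //; lia.
rewrite [LHS]/= !step /vstates /= !big_bool /=.
have vA B l : (forall j, (vedge r.-1 j \in B) = (vedge r.-1 j \in A)) ->
   [seq vedge r.-1 j \in B | j <- l] = [seq vedge r.-1 j \in A | j <- l].
  by move=> H; apply: eq_map => j; rewrite H.
rewrite /bulk_at /= !inE !eqxx !nhh !nhv !nvh !(negPf (nev _ _)) !nvh' /=.
rewrite !vA ?addrA //; by move=> j; rewrite !inE ?(negPf (nev _ _)) ?nvh'.
Qed.

(** The columns [j] and [2 n + 2 - j] carry the same parameter. *)
Lemma cols_iota r m : (r + m = n)%N ->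
  [seq c (minn j (2 * n + 2 - j)) | j <- iota r.+1 (2 * m).+1] =
  cols p [seq c k | k <- iota r.+1 m].
Proof.
move=> rm; have sz : size [seq c k | k <- iota r.+1 m] = m by rewrite size_map size_iota.
apply: (@eq_from_nth _ 0); first by rewrite size_map size_iota size_cols sz.
rewrite size_map size_iota => i im.
rewrite (nth_map 0%N) ?size_iota // nth_iota // /cols nth_cat sz.
case: ltnP => mi.
  by rewrite (nth_map 0%N) ?size_iota // nth_iota //; congr c; lia.
have [->|im'] := eqVneq i m; first by rewrite subnn /= -cp; congr c; lia.
have -> : (i - m = (i - m.+1).+1)%N by lia.
rewrite /= nth_rev ?sz; last by lia.
by rewrite (nth_map 0%N) ?size_iota ?nth_iota; [congr c| |]; lia.
Qed.

(** Below row [r] everything depends on the edges above only through the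
    vertical edges leaving row [r], so the sum over the rows below can be carried
    out first. *)
Lemma edge_sum_rows r m A : (0 < r)%N -> (r + m = n.+1)%N ->
  edge_sum (edges_from r m) (fun B => weight_from B r m) A =
  triangle p q [seq c k | k <- iota r m] (vstates A r.-1 (iota r (2 * m).+1)).
Proof.
elim: m r A => [|m IH] r A r0 rm //.
have inner B : edge_sum (edges_from r.+1 m) (fun B => row_weight B r m.+1 *
  weight_from B r.+1 m) B =
  row_weight B r m.+1 *
  triangle p q [seq c k | k <- iota r.+1 m] (vstates B r (iota r.+1 (2 * m).+1)).
  rewrite -IH //; last by lia.
  rewrite -edge_sum_scale; apply: eq_edge_sum => B' BB'; congr (_ * _).
  have E (b : bool) i j : (i <= r)%N -> ((b, vtx i j) \in B') = ((b, vtx i j) \in B).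
    move=> ir; apply: BB'; apply/negP => /edges_from_row /=.
    by rewrite inordK; lia.
  rewrite /row_weight /left_at /right_at /bulk_at /vedge /hedge.
  by rewrite !E ?leq_pred //; congr (_ * _ * _); apply: eq_bigr => j _; rewrite !E ?leq_pred.
have -> : edges_from r m.+1 = row_edges r m.+1 ++ edges_from r.+1 m by [].
rewrite edge_sum_cat.
have -> : (fun B => weight_from B r m.+1) = (fun B => row_weight B r m.+1 *
  weight_from B r.+1 m) by [].
have m2 : ((2 * m.+1).-1 = (2 * m).+1)%N by lia.
pose js := iota r.+1 (2 * m).+1.
have step B : edge_sum (bulk_edges r js) (edge_sum (edges_from r.+1 m)
      (fun B => row_weight B r m.+1 * weight_from B r.+1 m)) B =
   left_at B r * hline p q (c r) (cols p [seq c k | k <- iota r.+1 m])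
     (vstates B r.-1 (iota r.+1 (2 * m).+2)) (hedge r r \in B)
     (triangle p q [seq c k | k <- iota r.+1 m]).
  rewrite -(cols_iota (r := r)); last by lia.
  rewrite -edge_sum_row; try lia.
  rewrite -edge_sum_scale; apply: eq_edge_sum => B' BB'; rewrite inner /row_weight m2 -!mulrA.
  congr (_ * (_ * (_ * _))).
    rewrite /left_at; congr lbdry; apply: BB'; apply/negP => /mem_bulk_edges[j].
      move=> _ [] // /eqP; rewrite /vedge /vtx !xpair_eqE eqxx /= -val_eqE /= !inordK; lia.
    rewrite mem_iota => jr [] // /eqP; rewrite /hedge xpair_eqE eqxx /= vtx_inj; lia.
  by congr right_at; lia.
rewrite /row_edges m2 -/js edge_sum_cons !step.
have nhv i j : vedge i j == hedge r r = false by [].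
have vA (B : {set bool * grid n}) (b : bool) : (forall e, e != hedge r r -> (e \in B) =
  (e \in A)) ->
   (hedge r r \in B) = b -> left_at B r * hline p q (c r) (cols p [seq c k | k <- iota r.+1 m])
     (vstates B r.-1 (iota r.+1 (2 * m).+2)) (hedge r r \in B)
     (triangle p q [seq c k | k <- iota r.+1 m]) =
   lbdry p q (vedge r.-1 r \in A) b (c r) * hline p q (c r) (cols p [seq c k | k <- iota r.+1 m])
     (vstates A r.-1 (iota r.+1 (2 * m).+2)) b
     (triangle p q [seq c k | k <- iota r.+1 m]).
  move=> BA hb; rewrite /left_at hb BA ?nhv //; congr (_ * hline _ _ _ _ _ _ _).
  by apply: eq_map => j; rewrite BA ?nhv.
have -> : (2 * m.+1 = (2 * m).+2)%N by lia.
rewrite (vA _ true); [|by move=> e /negPf ne; rewrite !inE ne|by rewrite !inE eqxx].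
rewrite (vA _ false); [|by move=> e /negPf ne; rewrite !inE ne|by rewrite !inE eqxx].
by rewrite [RHS]/= big_bool.
Qed.

End Rows.

(** * Orientations and sets of edges *)

Section Orient.
Local Open Scope nat_scope.
Variable (n : nat).
Implicit Types (A : {set bool * grid n}) (x y : grid n) (o : {set grid n * grid n}).

Lemma vertical_edgeE x y : vertical_edge x y =
  [&& x.1 < x.2, x.2 <= 2 * n + 1 - x.1, y.1 == x.1.+1 :> nat & y.2 == x.2 :> nat].
Proof.
case: x y => [x1 x2] [y1 y2]; rewrite /vertical_edge /is_vertex /=.
have := ltn_ord x1; have := ltn_ord x2; have := ltn_ord y1; have := ltn_ord y2.
move: (nat_of_ord x1) (nat_of_ord x2) (nat_of_ord y1) (nat_of_ord y2) => a b c d.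
by case: (eqVneq a 0) => ?; case: (eqVneq c 0) => ?; lia.
Qed.

Lemma horizontal_edgeE x y : horizontal_edge x y =
  [&& 1 <= x.1 <= n, x.1 <= x.2, x.2 <= 2 * n + 1 - x.1, y.1 == x.1 :> nat & y.2 == x.2.+1 :> nat].
Proof.
case: x y => [x1 x2] [y1 y2]; rewrite /horizontal_edge /is_vertex /=.
have := ltn_ord x1; have := ltn_ord x2; have := ltn_ord y1; have := ltn_ord y2.
move: (nat_of_ord x1) (nat_of_ord x2) (nat_of_ord y1) (nat_of_ord y2) => a b c d.
by case: (eqVneq a 0) => ?; case: (eqVneq c 0) => ?; lia.
Qed.

Definition edges := @edges_from n 1 n.

Lemma mem_bulk_edgesE r js (e : bool * grid n) : r < n.+2 -> all (fun j => j < (2 * n).+2) js ->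
  (e \in bulk_edges n r js) = (e.2.1 == r :> nat) && (nat_of_ord e.2.2 \in js).
Proof.
move=> rn; case: e => b [x1 x2] /=; rewrite /bulk_edges.
elim: js => [|j js IH] /=; first by rewrite andbF.
case/andP=> jn ajs; rewrite !in_cons IH // andb_orr orbA; congr (_ || _).
rewrite /vedge /hedge /vtx !xpair_eqE -!val_eqE /= !inordK //.
by clear IH; case: b; rewrite /= ?orbF.
Qed.

Lemma mem_edges_from r m (e : bool * grid n) : 0 < r -> r + m = n.+1 ->
  (e \in edges_from n r m) = [&& r <= e.2.1, e.2.1 <= n, e.2.1 + e.1 <= e.2.2 & e.2.2 <= 2 * n +
    1 - e.2.1].
Proof.
elim: m r => [|m IH] r r0 rm; first by rewrite in_nil; lia.
rewrite /= in_cons mem_cat IH //; last by lia.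
rewrite mem_bulk_edgesE; [|lia|]; last first.
  by apply/allP => j; rewrite mem_iota; lia.
rewrite mem_iota; clear IH; case: e => b [x1 x2] /=.
by rewrite /hedge /vtx !xpair_eqE -!val_eqE /= !inordK //; lia.
Qed.

Lemma mem_edges (e : bool * grid n) :
  (e \in edges) = [&& 0 < e.2.1, e.2.1 <= n, e.2.1 + e.1 <= e.2.2 & e.2.2 <= 2 * n + 1 - e.2.1].
Proof. exact: mem_edges_from. Qed.

Lemma uniq_bulk_edges r js : r < n.+2 -> all (fun j => j < (2 * n).+2) js -> uniq js ->
  uniq (bulk_edges n r js).
Proof.
move=> rn; elim: js => [|j js IH] //= /andP[jn ajs] /andP[jjs ujs].
rewrite -/(bulk_edges n r js) IH // in_cons negb_or !mem_bulk_edgesE //=.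
by rewrite !inordK // (negPf jjs) andbF.
Qed.

Lemma uniq_edges_from r m : 0 < r -> r + m = n.+1 -> uniq (edges_from n r m).
Proof.
elim: m r => [|m IH] r r0 rm //.
have ajs : all (fun j => j < (2 * n).+2) (iota r.+1 (2 * m.+1).-1).
  by apply/allP => j; rewrite mem_iota; lia.
rewrite /edges_from -/edges_from /row_edges cons_uniq cat_uniq uniq_bulk_edges ?iota_uniq //;
  last lia.
rewrite IH //=; last lia.
rewrite mem_cat mem_bulk_edgesE //= ?mem_edges_from ?mem_iota //=; try lia.
rewrite !inordK; try lia.
rewrite andbT; apply/andP; split; first lia.
apply/hasPn => e; rewrite mem_edges_from ?mem_bulk_edgesE //; lia.
Qed.

Definition top_edges : {set bool * grid n} :=
  [set e : bool * grid n | [&& e.1, e.2.1 == 0 :> nat & 0 < e.2.2 <= 2 * n + 1]].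

Lemma mem_top_edges e :
  (e \in top_edges) = [&& e.1, e.2.1 == 0 :> nat & 0 < e.2.2 <= 2 * n + 1].
Proof. by rewrite /top_edges in_set. Qed.

(** The set of arcs encoded by [A], in the sense explained at [vtx]. *)
Definition orient A : {set grid n * grid n} :=
  [set a | [|| vertical_edge a.1 a.2 && ((true, a.1) \notin A),
               vertical_edge a.2 a.1 && ((true, a.2) \in A),
               horizontal_edge a.1 a.2 && ((false, a.1) \in A)
             | horizontal_edge a.2 a.1 && ((false, a.2) \notin A)]].

Lemma mem_orient A x y : ((x, y) \in orient A) =
  [|| vertical_edge x y && ((true, x) \notin A), vertical_edge y x && ((true, y) \in A),
      horizontal_edge x y && ((false, x) \in A)
    | horizontal_edge y x && ((false, y) \notin A)].
Proof. by rewrite /orient in_set. Qed.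

(** Inverse of [orient], restricted to the edges that are not top edges. *)
Definition edge_set o : {set bool * grid n} :=
  [set e in edges |
    if e.1 then [exists y, vertical_edge e.2 y && ((y, e.2) \in o)]
    else [exists y, horizontal_edge e.2 y && ((e.2, y) \in o)]].

Lemma mem_edge_set o e : (e \in edge_set o) = (e \in edges) &&
  if e.1 then [exists y, vertical_edge e.2 y && ((y, e.2) \in o)]
  else [exists y, horizontal_edge e.2 y && ((e.2, y) \in o)].
Proof. by rewrite /edge_set in_set. Qed.

Lemma adjacent_excl x y :
  [/\ vertical_edge x y -> [/\ vertical_edge y x = false, horizontal_edge x y =
    false & horizontal_edge y x = false],
      horizontal_edge x y -> [/\ vertical_edge x y = false, vertical_edge y x =
        false & horizontal_edge y x = false]
    & True].
Proof.
rewrite !vertical_edgeE !horizontal_edgeE.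
case: x y => [x1 x2] [y1 y2] /=.
move: (nat_of_ord x1) (nat_of_ord x2) (nat_of_ord y1) (nat_of_ord y2) => a b c d.
by split=> // H; split; apply/negP => H'; lia.
Qed.

Lemma orient_is_orientation A : is_orientation (orient A).
Proof.
apply/forallP => x; apply/forallP => y; rewrite !mem_orient /adjacent.
have [E1 E2 _] := adjacent_excl x y; have [E3 E4 _] := adjacent_excl y x.
case v1: (vertical_edge x y).
  by have [-> -> ->] := E1 v1; rewrite /= !orbF; case: (_ \in _).
case v2: (vertical_edge y x).
  by have [_ -> ->] := E3 v2; rewrite /= !orbF; case: (_ \in _).
case h1: (horizontal_edge x y).
  by have [_ _ ->] := E2 h1; rewrite /= !orbF; case: (_ \in _).
case h2: (horizontal_edge y x); rewrite //=; by case: (_ \in _).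
Qed.

Definition top_up o := [forall x, forall y,
  vertical_edge x y && (x.1 == 0 :> nat) ==> ((y, x) \in o)].

Lemma orient_top_up A : top_edges \subset A -> top_up (orient A).
Proof.
move=> tA; apply/forallP => x; apply/forallP => y; apply/implyP => /andP[vxy x0].
suff xA : (true, x) \in A by rewrite mem_orient vxy xA orbT.
by apply: (subsetP tA); rewrite mem_top_edges; move: x0 vxy => /eqP x0; rewrite vertical_edgeE /=
  x0; lia.
Qed.

Lemma edge_setK o : is_orientation o -> top_up o ->
  orient (top_edges :|: edge_set o) = o.
Proof.
move=> oo /forallP tu; have O x y := forallP (forallP oo x) y.
have V x y : vertical_edge x y -> ((true, x) \in top_edges :|: edge_set o) = ((y, x) \in o).
  move=> vxy; rewrite in_setU mem_top_edges mem_edge_set mem_edges /=.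
  have [x0|x0] := eqVneq (x.1 : nat) 0%N.
    have -> : (y, x) \in o by have := forallP (tu x) y; rewrite vxy x0 eqxx.
    by move: vxy; rewrite vertical_edgeE; lia.
  have -> : [&& 0 < x.1, x.1 <= n, x.1 + true <= x.2 & x.2 <= 2 * n + 1 - x.1].
    by move: vxy; rewrite vertical_edgeE; lia.
  rewrite /=; apply/existsP/idP => [[y' /andP[vy' yo]]|yo]; last by exists y; rewrite vxy.
  suff -> : y = y' by [].
  move: vxy vy'; rewrite !vertical_edgeE => /and4P[_ _ /eqP e1 /eqP e2] /and4P[_ _ /eqP e3 /eqP e4].
  case: y y' e1 e2 e3 e4 {yo} => [y1 y2] [z1 z2] /= e1 e2 e3 e4.
  by congr (_, _); apply: val_inj; rewrite /= ?e1 ?e3 ?e2 ?e4.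
have H x y : horizontal_edge x y -> ((false, x) \in top_edges :|: edge_set o) = ((x, y) \in o).
  move=> hxy; rewrite in_setU mem_top_edges mem_edge_set mem_edges /=.
  have -> : [&& 0 < x.1, x.1 <= n, x.1 + false <= x.2 & x.2 <= 2 * n + 1 - x.1].
    by move: hxy; rewrite horizontal_edgeE; lia.
  rewrite /=; apply/existsP/idP => [[y' /andP[vy' yo]]|yo]; last by exists y; rewrite hxy.
  suff -> : y = y' by [].
  move: hxy vy'; rewrite !horizontal_edgeE =>
    /and5P[_ _ _ /eqP e1 /eqP e2] /and5P[_ _ _ /eqP e3 /eqP e4].
  case: y y' e1 e2 e3 e4 {yo} => [y1 y2] [z1 z2] /= e1 e2 e3 e4.
  by congr (_, _); apply: val_inj; rewrite /= ?e1 ?e3 ?e2 ?e4.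
apply/setP => -[x y]; rewrite mem_orient.
have [E1 E2 _] := adjacent_excl x y; have [E3 E4 _] := adjacent_excl y x.
have := O x y; rewrite /adjacent.
case v1: (vertical_edge x y).
  by have [-> -> ->] := E1 v1; rewrite /= !orbF (V x y) //; case: (_ \in o); case: (_ \in o).
case v2: (vertical_edge y x).
  by have [_ -> ->] := E3 v2; rewrite /= !orbF (V y x) //; case: (_ \in o); case: (_ \in o).
case h1: (horizontal_edge x y).
  by have [_ _ ->] := E2 h1; rewrite /= !orbF (H x y) //; case: (_ \in o); case: (_ \in o).
case h2: (horizontal_edge y x) => /=; last by move/negbTE.
by rewrite (H y x) //; case: (_ \in o); case: (_ \in o).
Qed.

Lemma orientK (B : {set bool * grid n}) :
  (edge_set (orient (top_edges :|: B)) == B) = (B \subset edges).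
Proof.
apply/eqP/idP => [<-|BE]; first by apply/subsetP => e; rewrite mem_edge_set => /andP[].
suff key (b : bool) (x : grid n) :
    ((b, x) \in edge_set (orient (top_edges :|: B))) = ((b, x) \in B).
  by apply/setP => -[b x]; apply: key.
rewrite mem_edge_set; case: (boolP (_ \in edges)) => [|ne]; last first.
  by apply/esym/negbTE; apply: contra ne => /(subsetP BE).
rewrite mem_edges /= => xe.
have ex c d : c < n.+2 -> d < (2 * n).+2 -> exists y : grid n, y.1 = c :> nat /\ y.2 = d :> nat.
  by move=> hc hd; exists (Ordinal hc, Ordinal hd).
case: b xe => xe.
  have [y [y1 y2]] : exists y : grid n, y.1 = x.1.+1 :> nat /\ y.2 = x.2 :> nat.
    by apply: ex => //; lia.
  have vxy : vertical_edge x y by rewrite vertical_edgeE y1 y2; lia.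
  have N z : vertical_edge x z -> ((z, x) \in orient (top_edges :|: B)) = ((true, x) \in B).
    move=> vxz; rewrite mem_orient vxz; have [E _ _] := adjacent_excl x z; have [-> -> ->] := E vxz.
    rewrite /= ?orbF in_setU mem_top_edges /=; have -> : (x.1 == 0 :> nat) = false by lia.
    by [] .
  apply/existsP/idP => [[z /andP[vxz]]|xB]; first by rewrite N.
  by exists y; rewrite vxy N.
have [y [y1 y2]] : exists y : grid n, y.1 = x.1 :> nat /\ y.2 = x.2.+1 :> nat.
  by apply: ex => //; lia.
have hxy : horizontal_edge x y by rewrite horizontal_edgeE y1 y2; lia.
have N z : horizontal_edge x z -> ((x, z) \in orient (top_edges :|: B)) = ((false, x) \in B).
  move=> vxz; have [_ E _] := adjacent_excl x z; have [E1 E2 E3] := E vxz.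
  by rewrite mem_orient vxz E1 E2 E3 /= ?orbF in_setU mem_top_edges.
apply/existsP/idP => [[z /andP[vxz]]|xB]; first by rewrite N.
by exists y; rewrite hxy N.
Qed.
End Orient.

(** * Arcs around a vertex *)

Section OrientationSum.
Local Open Scope nat_scope.

(** Used for the numbers of incoming and outgoing edges at a bulk vertex. *)
Lemma card_four (T : finType) (a b c d : T) (p1 p2 p3 p4 : bool) :
  uniq [:: a; b; c; d] ->
  #|[set y | [|| (y == a) && p1, (y == b) && p2, (y == c) && p3 | (y == d) && p4]]| =
  p1 + p2 + p3 + p4.
Proof.
rewrite /= !inE !negb_or => /and4P[/and3P[ab ac ad] /andP[bc bd] cd _].
have S (x : T) (b0 : bool) : \sum_y ((y == x) && b0) = b0.
  by rewrite (bigD1 x) //= eqxx big1 ?addn0 // => y /negPf->.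
rewrite -sum1_card big_mkcond /= -(S a p1) -(S b p2) -(S c p3) -(S d p4) -!big_split /=.
apply: eq_bigr => y _; rewrite inE.
have [->|_] := eqVneq y a; first by rewrite (negPf ab) (negPf ac) (negPf ad); case: p1.
have [->|_] := eqVneq y b; first by rewrite (negPf bc) (negPf bd); case: p2.
have [->|_] := eqVneq y c; first by rewrite (negPf cd); case: p3.
by case: (y == d); case: p4.
Qed.

Variable n : nat.
Implicit Types (A : {set bool * grid n}) (x y : grid n).
Local Notation vtx := (@vtx n).
Local Notation vedge := (@vedge n).
Local Notation hedge := (@hedge n).

Lemma orient_vert A x y : vertical_edge x y ->
  ((y, x) \in orient A) = ((true, x) \in A) /\ ((x, y) \in orient A) = ((true, x) \notin A).
Proof.
move=> v; have [E _ _] := adjacent_excl x y; have [e1 e2 e3] := E v.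
by rewrite !mem_orient v e1 e2 e3 /= !orbF.
Qed.

Lemma orient_horiz A x y : horizontal_edge x y ->
  ((x, y) \in orient A) = ((false, x) \in A) /\ ((y, x) \in orient A) = ((false, x) \notin A).
Proof.
move=> v; have [_ E _] := adjacent_excl x y; have [e1 e2 e3] := E v.
by rewrite !mem_orient v e1 e2 e3 /= !orbF.
Qed.

Lemma vert_vtx r j : 0 < r <= n.+1 -> r <= j <= 2 * n + 2 - r ->
  vertical_edge (vtx r.-1 j) (vtx r j).
Proof. by move=> hr hj; rewrite vertical_edgeE /= !inordK; lia. Qed.

Lemma horiz_vtx r j : 0 < r <= n -> r < j <= 2 * n + 2 - r ->
  horizontal_edge (vtx r j.-1) (vtx r j).
Proof. by move=> hr hj; rewrite horizontal_edgeE /= !inordK; lia. Qed.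

Lemma val_vtx r j : r < n.+2 -> j < (2 * n).+2 ->
  ((vtx r j).1 = r :> nat) * ((vtx r j).2 = j :> nat).
Proof. by move=> hr hj; rewrite /= !inordK. Qed.

Lemma out_up_orient A r j : 0 < r <= n.+1 -> r <= j <= 2 * n + 2 - r ->
  out_up (orient A) (vtx r j) = (vedge r.-1 j \in A).
Proof.
move=> hr hj; rewrite /out_up val_vtx; try lia.
by have [-> _] := orient_vert A (vert_vtx hr hj).
Qed.

Lemma out_down_orient A r j : 0 <= r <= n -> r.+1 <= j <= 2 * n + 2 - r.+1 ->
  out_down (orient A) (vtx r j) = (vedge r j \notin A).
Proof.
move=> hr hj; rewrite /out_down val_vtx; try lia.
have hr' : 0 < r.+1 <= n.+1 by lia.
by have [_ ->] := orient_vert A (vert_vtx hr' hj).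
Qed.

Lemma out_left_orient A r j : 0 < r <= n -> r < j <= 2 * n + 2 - r ->
  out_left (orient A) (vtx r j) = (hedge r j.-1 \notin A).
Proof.
move=> hr hj; rewrite /out_left val_vtx; try lia.
by have [_ ->] := orient_horiz A (horiz_vtx hr hj).
Qed.

Lemma out_right_orient A r j : 0 < r <= n -> r <= j < 2 * n + 2 - r ->
  out_right (orient A) (vtx r j) = (hedge r j \in A).
Proof.
move=> hr hj; rewrite /out_right val_vtx; try lia.
have hj' : r < j.+1 <= 2 * n + 2 - r by lia.
by have [-> _] := orient_horiz A (horiz_vtx hr hj').
Qed.

Lemma vtxK x : vtx x.1 x.2 = x.
Proof. by case: x => a b; rewrite /vtx /= !inord_val. Qed.

Lemma balance_orient A r j : 0 < r <= n -> r < j < 2 * n + 2 - r ->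
  let o := orient A in
  let up := vedge r.-1 j \in A in let down := vedge r j \in A in
  let left := hedge r j.-1 \in A in let right := hedge r j \in A in
  (#|[set y | (vtx r j, y) \in o]| = up + ~~ down + ~~ left + right) *
  (#|[set y | (y, vtx r j) \in o]| = ~~ up + down + left + ~~ right).
Proof.
move=> hr hj o up down left right.
have V1 y : vertical_edge (vtx r j) y = (y == vtx r.+1 j).
  rewrite -{2}(vtxK y) vtx_inj ?ltn_ord //; try lia.
  by rewrite vertical_edgeE !val_vtx; lia.
have V2 y : vertical_edge y (vtx r j) = (y == vtx r.-1 j).
  rewrite -{2}(vtxK y) vtx_inj ?ltn_ord //; try lia.
  by rewrite vertical_edgeE !val_vtx; lia.
have H1 y : horizontal_edge (vtx r j) y = (y == vtx r j.+1).
  rewrite -{2}(vtxK y) vtx_inj ?ltn_ord //; try lia.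
  by rewrite horizontal_edgeE !val_vtx; lia.
have H2 y : horizontal_edge y (vtx r j) = (y == vtx r j.-1).
  rewrite -{2}(vtxK y) vtx_inj ?ltn_ord //; try lia.
  by rewrite horizontal_edgeE !val_vtx; lia.
have un : uniq [:: vtx r.-1 j; vtx r.+1 j; vtx r j.-1; vtx r j.+1].
  by rewrite /= !inE !vtx_inj; lia.
have T (b : bool) y z : (y == z) && ((b, y) \in A) = (y == z) && ((b, z) \in A).
  by case: eqP => [->|].
have T' (b : bool) y z : (y == z) && ((b, y) \notin A) = (y == z) && ((b, z) \notin A).
  by case: eqP => [->|].
rewrite -!(card_four _ _ _ _ un); split; apply: eq_card => y;
  rewrite [LHS]in_set [RHS]in_set /o mem_orient V1 V2 H1 H2 ?T ?T' orbCA.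
  by congr (_ || (_ || _)); apply: orbC.
rewrite orbCA; congr (_ || (_ || _)); exact: orbC.
Qed.

End OrientationSum.

(** * The sum over configurations *)

Section Partition.
Local Open Scope ring_scope.
Variables (K : fieldType) (p q : K) (n : nat) (u : 'I_n -> K).
Hypotheses (s2 : sigma (q ^+ 2) != 0) (s4 : sigma (q ^+ 4) != 0).
Local Notation vtx := (@vtx n).
Local Notation c := (param u p).

Definition balanced (o : {set grid n * grid n}) (x : grid n) : bool :=
  is_bulk x ==> (#|[set y | (y, x) \in o]| == 2) && (#|[set y | (x, y) \in o]| == 2).

(** The weight [1] of a turn is given by [bulk_weight] whatever the horizontal
    edges are, so the condition on the numbers of incoming and outgoing edges has to
    be imposed separately before the sum may range over all orientations. *)
Definition guarded_weight o x : K :=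
  if balanced o x then vertex_weight p q u p o x else 0.

Lemma Z_AST_orientations : Z_AST p q u p =
  \sum_(o | is_orientation o && top_up o)
    \prod_(x : grid n | is_vertex x) guarded_weight o x.
Proof.
rewrite /Z_AST [RHS](bigID (fun o => [forall x, balanced o x])) /=.
rewrite [X in _ = _ + X]big1 ?addr0.
  apply: eq_big => [o|o /and3P[_ /forallP bo _]].
    by rewrite /is_configuration -andbA [_ && top_up _]andbC.
  by apply: eq_bigr => x _; rewrite /guarded_weight (bo x : balanced o x).
move=> o /andP[_]; rewrite negb_forall => /existsP[x nb].
have bx : is_bulk x by move: nb; rewrite negb_imply => /andP[].
rewrite (bigD1 x) /=; last first.
  by move: bx; rewrite /is_bulk /is_vertex; case: eqP => ?; lia.
by rewrite /guarded_weight (negPf nb) mul0r.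
Qed.

Lemma Z_AST_edge_sum : Z_AST p q u p =
  edge_sum (edges n) (fun A => \prod_(x : grid n | is_vertex x) guarded_weight (orient A) x)
    (top_edges n).
Proof.
rewrite Z_AST_orientations edge_sum_subset; last 2 first.
- exact: uniq_edges_from.
- apply/pred0P => e /=; rewrite mem_top_edges mem_edges; apply/negP.
  by case/andP => /and3P[_ /eqP-> _].
rewrite (reindex_onto (fun B => orient (top_edges n :|: B)) (@edge_set n)) /=; last first.
  by move=> o /andP[oo ot]; apply: edge_setK.
apply: eq_bigl => B.
by rewrite orient_is_orientation orient_top_up ?subsetUl //= orientK.
Qed.

Lemma guarded_bulk A r j : (0 < r <= n)%N -> (r < j < 2 * n + 2 - r)%N ->
  guarded_weight (orient A) (vtx r j) = bulk_at q c A r j / sigma (q ^+ 4).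
Proof.
move=> hr hj; have bx : is_bulk (vtx r j) by rewrite /is_bulk !val_vtx; lia.
rewrite /guarded_weight /balanced /vertex_weight bx /=.
case: (balance_orient A hr hj) => -> ->.
rewrite out_up_orient ?out_down_orient ?out_left_orient ?out_right_orient; try lia.
rewrite !inordK; try lia.
rewrite /bulk_at; case: (_ \in A); case: (_ \in A); case: (_ \in A); case: (_ \in A);
  rewrite /= ?mul0r ?divff //.
Qed.

Lemma guarded_left A r : (0 < r <= n)%N ->
  guarded_weight (orient A) (vtx r r) = left_at p q c A r / sigma (q ^+ 2).
Proof.
move=> hr; have bx : is_bulk (vtx r r) = false by rewrite /is_bulk !val_vtx; lia.
have lx : is_left_boundary (vtx r r) by rewrite /is_left_boundary !val_vtx; lia.
rewrite /guarded_weight /balanced /vertex_weight bx lx /=.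
rewrite out_up_orient ?out_right_orient; try lia.
rewrite inordK; last lia.
by rewrite /left_at; case: (_ \in A); case: (_ \in A); rewrite /= ?mul0r.
Qed.

Lemma guarded_right A r j : (0 < r <= n)%N -> (j = 2 * n + 2 - r)%N ->
  guarded_weight (orient A) (vtx r j) = right_at p q c A r j / sigma (q ^+ 2).
Proof.
move=> hr hj; have bx : is_bulk (vtx r j) = false by rewrite /is_bulk !val_vtx; lia.
have lx : is_left_boundary (vtx r j) = false by rewrite /is_left_boundary !val_vtx; lia.
have rx : is_right_boundary (vtx r j) by rewrite /is_right_boundary !val_vtx; lia.
rewrite /guarded_weight /balanced /vertex_weight bx lx rx /=.
rewrite out_up_orient ?out_left_orient; try lia.
rewrite inordK; last lia.
rewrite /right_at; case: (_ \in A); case: (_ \in A); rewrite /= ?mul0r //;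
  congr (sigma _ / _).
- by rewrite mulrC.
- by rewrite exprVn.
- by rewrite invfM [RHS]mulrA [q ^+ 2 / p]mulrC.
Qed.

Lemma guarded_outer o x : is_vertex x -> ~~ (0 < x.1 <= n)%N -> guarded_weight o x = 1.
Proof.
move=> vx nx; rewrite /guarded_weight /balanced /vertex_weight.
rewrite /is_bulk /is_left_boundary /is_right_boundary.
by rewrite (negPf nx).
Qed.

Fixpoint verts_from r m : seq (grid n) :=
  if m is m'.+1 then [seq vtx r j | j <- iota r (2 * m).+1] ++ verts_from r.+1 m' else [::].

Lemma verts_fromS r m : verts_from r m.+1 =
  [seq vtx r j | j <- iota r (2 * m.+1).+1] ++ verts_from r.+1 m.
Proof. by []. Qed.

Lemma mem_verts_from r m (x : grid n) : (0 < r)%N -> (r + m = n.+1)%N ->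
  (x \in verts_from r m) = (r <= x.1 <= n)%N && (x.1 <= x.2 <= 2 * n + 2 - x.1)%N.
Proof.
elim: m r => [|m IH] r r0 rm; first by rewrite in_nil; lia.
rewrite verts_fromS mem_cat IH //; last by lia.
have -> : (x \in [seq vtx r j | j <- iota r (2 * m.+1).+1]) =
    (x.1 == r :> nat) && (r <= x.2 <= r + 2 * m.+1)%N.
  apply/mapP/andP => [[j]|[/eqP x1 x2]].
    by rewrite mem_iota => ji ->; rewrite !val_vtx; lia.
  by exists (nat_of_ord x.2); [rewrite mem_iota; lia | rewrite -x1 vtxK].
lia.
Qed.

Lemma uniq_verts_from r m : (0 < r)%N -> (r + m = n.+1)%N -> uniq (verts_from r m).
Proof.
elim: m r => [|m IH] r r0 rm //.
rewrite verts_fromS cat_uniq IH ?andbT //; last by lia.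
apply/andP; split.
  rewrite map_inj_in_uniq ?iota_uniq // => i j; rewrite !mem_iota => hi hj /eqP.
  by rewrite vtx_inj; lia.
apply/hasPn => x; rewrite mem_verts_from //; last lia.
move=> hx; apply/mapP => -[j]; rewrite mem_iota => ji xE.
by move: hx; rewrite xE !val_vtx; lia.
Qed.

Lemma prod_verts_from A r m : (0 < r)%N -> (r + m = n.+1)%N ->
  \prod_(x <- verts_from r m) guarded_weight (orient A) x =
  weight_from p q c A r m / (sigma (q ^+ 2) ^+ (2 * m) * sigma (q ^+ 4) ^+ (m * m)).
Proof.
elim: m r => [|m IH] r r0 rm; first by rewrite big_nil /= !expr0 mulr1 divr1.
have -> : weight_from p q c A r m.+1 = row_weight p q c A r m.+1 * weight_from p q c A r.+1 m by [].
have V : \prod_(j <- iota r.+1 (2 * m).+1) guarded_weight (orient A) (vtx r j) =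
  (\prod_(j <- iota r.+1 (2 * m).+1) bulk_at q c A r j) / sigma (q ^+ 4) ^+ (2 * m).+1.
  transitivity (\prod_(j <- iota r.+1 (2 * m).+1) (bulk_at q c A r j / sigma (q ^+ 4))).
    apply: eq_big_seq => j; rewrite mem_iota => ji.
    by rewrite guarded_bulk //; lia.
  by rewrite big_split; congr (_ * _);
    rewrite big_const_seq count_predT size_iota iter_mulr_1 exprVn.
rewrite verts_fromS big_cat IH //; last lia.
rewrite big_map.
have -> : iota r (2 * m.+1).+1 = r :: iota r.+1 (2 * m).+1 ++ [:: (r + 2 * m.+1)%N].
  have -> : ((2 * m.+1).+1 = 1 + ((2 * m).+1 + 1))%N by lia.
  by rewrite !iotaD addn1; congr (_ :: (_ ++ [:: _])); lia.
rewrite big_cons big_cat big_cons big_nil V.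
rewrite guarded_left ?guarded_right; try lia.
rewrite /row_weight (_ : (2 * m.+1).-1 = (2 * m).+1); last lia.
rewrite (_ : (2 * m.+1 = 1 + 1 + 2 * m)%N); last lia.
rewrite (_ : (m.+1 * m.+1 = (2 * m).+1 + m * m)%N); last lia.
rewrite [in RHS]exprD [in RHS]exprD [in RHS]exprD.
by rewrite /=; field; rewrite ?expf_neq0 ?s2 ?s4.
Qed.

Theorem Z_AST_triangle_up : Z_AST p q u p =
  triangle_up p q [seq u i | i <- enum 'I_n] /
    (sigma (q ^+ 2) ^+ (2 * n) * sigma (q ^+ 4) ^+ (n * n)).
Proof.
rewrite Z_AST_edge_sum; set D := sigma (q ^+ 2) ^+ _ * _.
have cp : c n.+1 = p by rewrite /param insubF //= ltnn.
transitivity (edge_sum (edges n) (fun A => D^-1 * weight_from p q c A 1 n) (top_edges n)).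
  apply: eq_edge_sum => A _; rewrite [RHS]mulrC /D -prod_verts_from //.
  rewrite (bigID (fun x : grid n => (0 < x.1 <= n)%N)) /= [X in _ * X]big1 ?mulr1; last first.
    by move=> x /andP[]; apply: guarded_outer.
  rewrite [RHS]big_uniq ?uniq_verts_from //=.
  apply: eq_bigl => x; rewrite mem_verts_from // /is_vertex.
  by case: eqP => ?; lia.
rewrite edge_sum_scale mulrC edge_sum_rows //; congr (_ / _).
have -> : [seq c k | k <- iota 1 n] = [seq u i | i <- enum 'I_n].
  rewrite (iotaDl 1 0) -val_enum_ord -!map_comp; apply: eq_map => i /=.
  by rewrite /param valK.
rewrite /triangle_up /up_top size_map size_enum_ord; congr triangle.
apply: (@eq_from_nth _ true); first by rewrite size_map size_iota size_nseq.
rewrite size_map size_iota => i hi; rewrite nth_nseq hi (nth_map 0%N) ?size_iota //.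
by rewrite nth_iota // mem_top_edges /= !inordK; lia.
Qed.
End Partition.

(** * Genericity of the indeterminates *)

Section Transcendence.
Variables (F : fieldType) (n : nat).
Local Notation N := (2 + n)%N.

(** Distinct monomials in the indeterminates are distinct rational functions, so each
    condition of [generic] is a comparison of exponents; nearly always the exponent
    of [q] decides. *)
Definition mono (m : 'X_{1.. N}) : ratfun F n := tofrac 'X_[m].

Lemma mono_inj : injective mono.
Proof.
move=> m1 m2 /eqP; rewrite /mono tofrac_eq => /eqP E.
have : ('X_[m1] : {mpoly F[N]})@_m1 = 1 by rewrite mcoeffX eqxx.
rewrite E mcoeffX; case: eqP => [->//|_] /eqP.
by rewrite eq_sym oner_eq0.
Qed.

Lemma monoM m1 m2 : mono m1 * mono m2 = mono (m1 + m2).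
Proof. by rewrite /mono mpolyXD tofracM. Qed.

Lemma monoX m k : mono m ^+ k = mono (m *+ k).
Proof. by rewrite /mono -mpolyXn tofracXn. Qed.

Lemma mono0 : 1 = mono 0.
Proof. by rewrite /mono mpolyX0 tofrac1. Qed.

Lemma mono_neq0 m : mono m != 0.
Proof.
rewrite /mono tofrac_eq0; apply/eqP => E.
have : ('X_[m] : {mpoly F[N]})@_m = 1 by rewrite mcoeffX eqxx.
by rewrite E mcoeff0 => /eqP; rewrite eq_sym oner_eq0.
Qed.

Let kq : 'I_N := lshift n ord_max.

Lemma mono_neq (m1 m2 : 'X_{1.. N}) : m1 kq <> m2 kq -> mono m1 != mono m2.
Proof. by move=> ne; apply/eqP => /mono_inj E; apply: ne; rewrite E. Qed.

Lemma indet_qfree k : (0 < k)%N -> indet_q F n ^+ k != 1.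
Proof.
move=> k0; rewrite -[indet_q F n]/(mono U_(kq)) monoX mono0.
by apply: mono_neq; rewrite mulmnE mnm1E mnm0E eqxx; lia.
Qed.

Lemma indet_generic :
  generic (indet_q F n) (indet_p F n :: [seq @indet_u F n i | i <- enum 'I_n]).
Proof.
pose ks := lshift n ord0 :: [seq rshift 2 i | i <- enum 'I_n] : seq 'I_N.
have -> : indet_p F n :: [seq indet_u F i | i <- enum 'I_n] = [seq mono U_(k) | k <- ks].
  by rewrite /= -map_comp.
have kq0 k : k \in ks -> (U_(k)%MM : 'X_{1.. N}) kq = 0%N.
  rewrite mnm1E in_cons => /orP[/eqP->|/mapP[i _ ->]] //.
have uks : uniq ks.
  rewrite /= map_inj_uniq ?enum_uniq ?andbT; last exact: rshift_inj.
  by apply/mapP => -[i _ /eqP]; rewrite eq_lrshift.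
rewrite -[indet_q F n]/(mono U_(kq)); split.
- by apply/allP => _ /mapP[k _ ->]; apply: mono_neq0.
- rewrite -map_comp map_inj_in_uniq // => k l _ _ /=; rewrite !monoX => /mono_inj E.
  have := congr1 (fun m : 'X_{1.. N} => m k) E.
  by rewrite !mulmnE !mnm1E eqxx; case: eqP.
- move=> _ /mapP[k /kq0 k0 ->]; rewrite !monoX monoM mono0.
  apply/andP; split; apply: mono_neq; rewrite (mnmDE, mulmnE) ?mnm0E.
    by rewrite !mulmnE k0 mnm1E eqxx; lia.
  by rewrite k0 mulmnE mnm1E eqxx.
- move=> _ _ /mapP[k /kq0 k0 ->] /mapP[l /kq0 l0 ->]; rewrite !monoX !monoM mono0.
  have E a : ((U_(k) *+ 2 + U_(l) *+ 2)%MM kq = 0%N) * ((U_(kq) *+ a)%MM kq = a).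
    by rewrite mnmDE !mulmnE k0 l0 mnm1E eqxx mul1n.
  apply/and3P; split; apply: mono_neq.
  - by rewrite (E 4%N).1 (E 4%N).2.
  - by rewrite mnm0E mnmDE (E 4%N).1 (E 4%N).2.
  - by rewrite mnmDE (E 8%N).2 !mulmnE k0 l0.
Qed.
End Transcendence.

(** * The formula *)

Lemma vandermonde_enum (K : fieldType) n (u : 'I_n -> K) :
  vandermonde [seq u i | i <- enum 'I_n] =
  \prod_(i < n) \prod_(j < n | (i < j)%N) sigma (u i / u j) ^+ 2.
Proof.
elim: n u => [|n IH] u; first by rewrite big_ord0 (size0nil (size_enum_ord 0)).
rewrite enum_ordSl /= -map_comp (IH (u \o lift ord0)) big_ord_recl; congr (_ * _).
  rewrite big_map [RHS]big_mkcond big_ord_recl /= mul1r.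
  by rewrite big_enum; apply: eq_bigr => i _.
apply: eq_bigr => i _; rewrite [RHS]big_mkcond big_ord_recl /= mul1r.
by rewrite big_mkcond; apply: eq_bigr => j _; rewrite /= ltnS.
Qed.

Theorem Z_AST_generic (K : fieldType) (p q : K) n (u : 'I_n -> K) :
    p != 0 -> q != 0 -> (forall k, (0 < k)%N -> q ^+ k != 1) ->
    generic q (p :: [seq u i | i <- enum 'I_n]) ->
  Z_AST p q u p =
    ((\prod_(i < n) (sigma (q ^+ 2 * p * u i)
                     * sigma (q ^+ 2 * p^-1 * (u i)^-1)))
     * (\prod_(i < n) \prod_(j < n)
          (sigma (q ^+ 2 * u i * u j)
           * sigma (q ^+ 2 * (u i)^-1 * (u j)^-1))))
    / (sigma (q ^+ 2) ^+ (2 * n) * sigma (q ^+ 4) ^+ (n * (n - 1))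
       * \prod_(i < n) \prod_(j < n | (i < j)%N) sigma (u i * (u j)^-1) ^+ 2)
    * \det (\matrix_(i < n, j < n)
        (1 / (sigma (q ^+ 2 * u i * u j)
              * sigma (q ^+ 2 * (u i)^-1 * (u j)^-1)))).
Proof.
move=> p0 q0 qfree gen.
have [nz un _ g2] := gen.
have ui i : u i \in p :: [seq u i | i <- enum 'I_n].
  by rewrite in_cons map_f ?orbT // mem_enum.
have u0 i : u i != 0 by apply: (allP nz _ (ui i)).
have s2 : sigma (q ^+ 2) != 0 by rewrite sigma_eq0 ?expf_neq0 // -exprM qfree.
have s4 : sigma (q ^+ 4) != 0 by rewrite sigma_eq0 ?expf_neq0 // -exprM qfree.
have d0 i j : pair_factor q (u i) (u j) != 0.
  have /and3P[n1 n2 _] := g2 _ _ (ui i) (ui j).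
  rewrite /pair_factor mulf_neq0 // sigma_eq0 ?mulf_neq0 ?invr_eq0 ?mulf_neq0 ?expf_neq0 //.
    apply: contraNneq n2 => E; apply/eqP; rewrite -[RHS]E; ring.
  apply: contraNneq n1 => E; apply/eqP; rewrite -[LHS]mul1r -E; field.
  by rewrite !u0.
have /injectiveP inj : injectiveb (fun i => u i ^+ 2).
  by move: un; rewrite map_cons cons_uniq -map_comp => /andP[].
have v0 : vandermonde [seq u i | i <- enum 'I_n] != 0.
  rewrite vandermonde_enum; apply/prodf_neq0 => i _; apply/prodf_neq0 => j ij.
  rewrite expf_neq0 // sigma_eq0 ?mulf_neq0 ?invr_eq0 //; apply/eqP => E.
  have /inj ji : u i ^+ 2 = u j ^+ 2 by rewrite -[RHS]mul1r -E; field.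
  by rewrite ji ltnn in ij.
have := factorized_generic q0 p0 qfree gen.
rewrite /factorized size_map size_enum_ord => C.
rewrite Z_AST_triangle_up //.
have -> : triangle_up p q [seq u i | i <- enum 'I_n] =
  sigma (q ^+ 4) ^+ n * bdry_factor p q [seq u i | i <- enum 'I_n] *
   pair_det q [seq u i | i <- enum 'I_n] / vandermonde [seq u i | i <- enum 'I_n] by rewrite -C mulfK.
have nthE (l : 'I_n) : [seq u i | i <- enum 'I_n]`_l = u l.
  by rewrite (nth_map l) ?size_enum_ord // nth_ord_enum.
have -> : pair_det q [seq u i | i <- enum 'I_n] =
   (\prod_i \prod_j pair_factor q (u i) (u j)) *
   \det (\matrix_(i, j) (pair_factor q (u i) (u j))^-1).
  have sz : size [seq u i | i <- enum 'I_n] = n by rewrite size_map size_enum_ord.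
  rewrite pair_det_inv // (pair_detE q sz).
  congr (\det _); apply/matrixP => i j; rewrite !mxE; apply: eq_bigr => l _.
  by rewrite !nthE.
have -> : bdry_factor p q [seq u i | i <- enum 'I_n] =
  \prod_(i < n) (sigma (q ^+ 2 * p * u i) * sigma (q ^+ 2 * p^-1 * (u i)^-1)).
  rewrite /bdry_factor big_map big_enum; apply: eq_bigr => i _.
  by rewrite /bdry_factor1 invfM mulrA.
have dE i j : sigma (q ^+ 2 * u i * u j) * sigma (q ^+ 2 * (u i)^-1 * (u j)^-1) =
  pair_factor q (u i) (u j) by rewrite /pair_factor invfM !mulrA.
have -> : \prod_(i < n) \prod_(j < n)
          (sigma (q ^+ 2 * u i * u j) * sigma (q ^+ 2 * (u i)^-1 * (u j)^-1)) =
    \prod_i \prod_j pair_factor q (u i) (u j).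
  by apply: eq_bigr => i _; apply: eq_bigr => j _; rewrite dE.
have -> : \matrix_(i < n, j < n)
        (1 / (sigma (q ^+ 2 * u i * u j)
              * sigma (q ^+ 2 * (u i)^-1 * (u j)^-1))) =
   \matrix_(i, j) (pair_factor q (u i) (u j))^-1.
  by apply/matrixP => i j; rewrite !mxE dE div1r.
rewrite vandermonde_enum in v0 *.
have -> : sigma (q ^+ 4) ^+ (n * n) = sigma (q ^+ 4) ^+ (n * (n - 1)) * sigma (q ^+ 4) ^+ n.
  by rewrite -exprD; congr (_ ^+ _); nia.
by field; rewrite ?v0 ?expf_neq0 ?s2 ?s4.
Qed.

Theorem corollary5p2 (F : fieldType) (n : nat) (hn : (0 < n)%N) :
  let p := indet_p F n in
  let q := indet_q F n in
  let u := @indet_u F n in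
  Z_AST p q u p =
    ((\prod_(i < n) (sigma (q ^+ 2 * p * u i)
                     * sigma (q ^+ 2 * p^-1 * (u i)^-1)))
     * (\prod_(i < n) \prod_(j < n)
          (sigma (q ^+ 2 * u i * u j)
           * sigma (q ^+ 2 * (u i)^-1 * (u j)^-1))))
    / (sigma (q ^+ 2) ^+ (2 * n) * sigma (q ^+ 4) ^+ (n * (n - 1))
       * \prod_(i < n) \prod_(j < n | (i < j)%N) sigma (u i * (u j)^-1) ^+ 2)
    * \det (\matrix_(i < n, j < n)
        (1 / (sigma (q ^+ 2 * u i * u j)
              * sigma (q ^+ 2 * (u i)^-1 * (u j)^-1)))).
Proof.
move=> p q u; apply: Z_AST_generic.
- exact: mono_neq0.
- exact: mono_neq0.
- exact: indet_qfree.
- exact: indet_generic.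
Qed.
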